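(* Let $n$ and $q$ be positive integers with $q\ge 2$. There exists an edge-ordered graph $G$ on $N = 2^{8^{q+1}n^{2q-2}(\log_2 n)^q}$ vertices such that, for every $q$-coloring of the edges of $G$, there exists a monochromatic subgraph of $G$ containing a copy of every $n$-vertex edge-ordered graph $H$.
   Context: An edge-ordered graph is a finite simple graph together with a total ordering of its edges (equivalently, an assignment of distinct integer labels to its edges). Two edge-ordered graphs are equivalent if there is a graph isomorphism between them preserving the ordering of the edges. An edge-ordered graph $G$ contains a copy of an edge-ordered graph $H$ if some subgraph of $G$, with the edge-ordering inherited from $G$, is equivalent to $H$. *)

(* Defs.v *)
From mathcomp Require Import all_boot all_order all_algebra.
From mathcomp Require Import reals exp.

Set Implicit Arguments.
Unset Strict Implicit.
Unset Printing Implicit Defensive.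

Import Order.TTheory GRing.Theory Num.Theory.

(* Graphs carry a vertex set inside an ambient finite type, so that a subgraph
   of G is again an edge-ordered graph over the same ambient type.  An edge is
   a two-element set of vertices; edge_le is only constrained, and only
   meaningful, on edges. *)
Record eograph (T : finType) := EOGraph {
  vertices : {set T};
  edges : {set {set T}};
  edge_le : rel {set T};
  edges_sub : {in edges, forall e : {set T}, e \subset vertices};
  edges_card2 : {in edges, forall e : {set T}, #|e| = 2};
  edge_le_anti : {in edges &, antisymmetric edge_le};
  edge_le_trans : {in edges & &, transitive edge_le};
  edge_le_total : {in edges &, total edge_le}
}.

Definition subgraph (T : finType) (S G : eograph T) : Prop :=
  [/\ vertices S \subset vertices G,
      edges S \subset edges G &
      {in edges S &, edge_le S =2 edge_le G}].

(* The values of f outside vertices G are irrelevant. *)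
Definition equivalent (T U : finType) (G : eograph T) (H : eograph U) : Prop :=
  exists f : T -> U,
    [/\ {in vertices G &, injective f},
        f @: vertices G = vertices H,
        {in vertices G &, forall x y,
           ([set x; y] \in edges G) = ([set f x; f y] \in edges H)} &
        {in edges G &, forall d e,
           edge_le G d e = edge_le H (f @: d) (f @: e)}].

Definition contains_copy (T U : finType) (G : eograph T) (H : eograph U) :
    Prop :=
  exists2 S : eograph T, subgraph S G & equivalent S H.

(* An edge coloring is a function on all sets of vertices, of which only the
   values on edges are used. *)
Definition monochromatic (T : finType) (q : nat) (c : {set T} -> 'I_q)
    (S : eograph T) : Prop :=
  exists i : 'I_q, {in edges S, forall e, c e = i}.

Local Open Scope ring_scope.

Definition log2 (R : realType) (x : R) : R := ln x / ln 2.

(* The bound 2 ^ (8 ^ (q+1) * n ^ (2q-2) * (log_2 n) ^ q) need not be an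
   integer, hence the rounding down in num_vertices. *)
Definition vertex_bound (R : realType) (n q : nat) : R :=
  2 `^ (8 ^+ q.+1 * n%:R ^+ (2 * q - 2) * log2 n%:R ^+ q).

Definition num_vertices (R : realType) (n q : nat) : nat :=
  Num.truncn (vertex_bound R n q).

(* Main.v *)
(** The host is a complete graph on the vectors of F^h, the edge vw carrying the
label <v, w> in F and edges being compared by label; any two distinct labels
then order their edges.  Suppose that colour i contains no copy of H_i, for
every i.

Trying to embed H_k greedily in colour k, with the rank of each edge of H_k
prescribed as the next digit of the labels, fails at a pair of large sets (A, B)
and a block of labels such that colour k is sparse in that block between A and
B.  Restricting all labels to this block and iterating in a binary tree of depth
log n yields n large sets that are pairwise sparse in colour k.  The tree is
explored one subtree at a time: once the sets below A are chosen, B is replaced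
by its vertices of low degree to all of them, so that sparseness is inherited.
Doing this inside families that are already sparse in the colours below k, one
gets n sets pairwise sparse in all colours but the last, in one block of labels.
There the last colour is embedded greedily; by a second moment computation the
dot product is so uniform that the average vertex does not increase the density
of the other colours in the neighbourhoods it determines. *)

Require Import Defs.
From mathcomp Require Import all_boot all_order all_algebra all_field.
From mathcomp Require Import boolp reals exp.
From mathcomp Require Import zify ring.

Set Implicit Arguments.
Unset Strict Implicit.
Unset Printing Implicit Defensive.

Import Order.TTheory GRing.Theory Num.Theory.

(** * Edge counts *)

Section Counting.
Variable T : finType.
Implicit Types (A B X Y : {set T}) (E : rel T) (f : T -> nat).

Definition deg E v B := #|[set w in B | E v w]|.
Definition edg E A B := \sum_(v in A) deg E v B.

Lemma card_filter A (P : pred T) : #|[set x in A | P x]| = \sum_(x in A) P x.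
Proof.
rewrite -sum1_card (eq_bigl (fun x => (x \in A) && P x)); last first.
  by move=> x; rewrite inE.
by rewrite big_mkcondr.
Qed.

Lemma edgC E A B : edg E A B = \sum_(w in B) #|[set v in A | E v w]|.
Proof.
rewrite /edg /deg; under eq_bigr do rewrite card_filter.
by rewrite exchange_big; under [RHS]eq_bigr do rewrite card_filter.
Qed.

Lemma deg_leq E v B : deg E v B <= #|B|.
Proof. by apply/subset_leq_card/subsetP=> w; rewrite inE => /andP[]. Qed.

Lemma deg_sub E1 E2 v B1 B2 : subrel E1 E2 -> B1 \subset B2 ->
  deg E1 v B1 <= deg E2 v B2.
Proof.
move=> sE sB; apply/subset_leq_card/subsetP=> w; rewrite !inE.
by case/andP=> /(subsetP sB)-> /sE->.
Qed.

Lemma leq_sum_sub A B f : A \subset B -> \sum_(v in A) f v <= \sum_(v in B) f v.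
Proof. by move=> sAB; rewrite [leqRHS](big_setID A) /= (setIidPr sAB) leq_addr. Qed.

Lemma edg_sub E1 E2 A1 A2 B1 B2 : subrel E1 E2 -> A1 \subset A2 ->
  B1 \subset B2 -> edg E1 A1 B1 <= edg E2 A2 B2.
Proof.
move=> sE sA sB; apply: (leq_trans (leq_sum_sub _ sA)).
by apply: leq_sum => v _; apply: deg_sub.
Qed.

Lemma markov_count A f K : #|[set v in A | K < f v]| * K <= \sum_(v in A) f v.
Proof.
rewrite card_filter big_distrl /=; apply: leq_sum => v _.
by case: ltnP => [/ltnW|]; rewrite ?mul1n ?mul0n.
Qed.

Lemma card_filterC A (P : pred T) :
  #|[set x in A | P x]| + #|[set x in A | ~~ P x]| = #|A|.
Proof.
rewrite -(cardsID [set x | P x] A); congr (_ + _); apply: eq_card => x;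
  by rewrite !inE // andbC.
Qed.

(** Markov's inequality at a level [K] of at least twice the mean: at most half of [A] exceeds
    it. *)
Lemma markov_half A f K : 0 < K -> 2 * \sum_(v in A) f v <= #|A| * K ->
  #|A| <= 2 * #|[set v in A | f v <= K]|.
Proof.
move=> K_gt0 le_f; have := markov_count A f K.
have := card_filterC A (fun v => f v <= K).
rewrite (_ : [set v in A | ~~ (f v <= K)] = [set v in A | K < f v]); last first.
  by apply/setP=> v; rewrite !inE ltnNge.
set a := #|[set v in A | f v <= K]|; set b := #|[set v in A | K < f v]|.
by move=> eqA le_b; rewrite -eqA in le_f *; nia.
Qed.

(** A main term plus an error: generic elements pay [a], exceptional ones the trivial bound [b]. The
    exceptions will be atypical vertices in the embedding and proportional vectors in the second
    moment. *)
Lemma sum_split_leq X (P : pred T) (f : T -> nat) a b :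
    (forall v, v \in X -> P v -> f v <= a) -> (forall v, v \in X -> f v <= b) ->
  \sum_(v in X) f v <= #|X| * a + #|[set v in X | ~~ P v]| * b.
Proof.
move=> le_a le_b; rewrite card_filter big_distrl -sum_nat_const -big_split /=.
apply: leq_sum => v vX; case Pv: (P v); first by rewrite mul0n addn0 le_a.
by rewrite mul1n (leq_trans (le_b v vX)) ?leq_addl.
Qed.

(* Each vertex of the first set either keeps a 1/e fraction of every later set,
   so that it can be used as the next vertex, or is sparse towards one of them. *)
Lemma greedy_or_sparse (x0 : T) (e : nat) : 0 < e ->
  forall n (E : nat -> nat -> rel T) (X : nat -> {set T}),
  (forall i, i < n -> 0 < #|X i|) ->
  (exists v : nat -> T, (forall i, i < n -> v i \in X i) /\
     forall i j, i < j < n -> E i j (v i) (v j)) \/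
  exists i j A B, [/\ i < j < n, A \subset X i, B \subset X j,
     #|X i| <= #|A| * (n * e ^ n) /\ #|X j| <= #|B| * (n * e ^ n) &
     forall v, v \in A -> deg (E i j) v B * e <= #|B|].
Proof.
move=> e_gt0; elim=> [|n IHn] E X X_gt0.
  by left; exists (fun=> x0); split=> [//|i j]; rewrite ltn0 andbF.
have e_exp m : 0 < e ^ m by rewrite expn_gt0 e_gt0.
pose bad v b := deg (E 0 b.+1) v (X b.+1) * e <= #|X b.+1|.
have [/existsP[v /andP[vX /forallP good]] | no_good] :=
    boolP [exists v, (v \in X 0) && [forall b : 'I_n, ~~ bad v b]].
  (* A vertex good towards all later sets is taken first; the others are sought in its
     neighbourhoods, each smaller by a factor of at most [e]. *)
  pose X' b := [set w in X b.+1 | E 0 b.+1 v w].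
  have X'_size b : b < n -> #|X b.+1| <= #|X' b| * e.
    by move=> lt_b; have /= := good (Ordinal lt_b); rewrite -ltnNge => /ltnW.
  have X'_gt0 b : b < n -> 0 < #|X' b|.
    move=> lt_b; have := X'_size _ lt_b; have := X_gt0 b.+1 lt_b.
    by case: #|X' b| => //; case: #|X b.+1|.
  have [[u [uX uE]] | [i [j [A [B [lt_ij sA sB [cA cB] deg_le]]]]]] :=
    IHn (fun i j => E i.+1 j.+1) X' X'_gt0.
    left; exists (fun i => if i is i'.+1 then u i' else v); split.
      by case=> // i lt_i; have := uX i lt_i; rewrite inE => /andP[].
    case=> [|i] [|j] //= lt_ij; last exact: uE.
    by have := uX j lt_ij; rewrite inE => /andP[].
  have sX' b : X' b \subset X b.+1 by apply/subsetP=> w; rewrite inE => /andP[].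
  right; exists i.+1, j.+1, A, B; split=> //; try exact: subset_trans (sX' _).
  have bound b C : b < n -> #|X' b| <= #|C| * (n * e ^ n) ->
      #|X b.+1| <= #|C| * (n.+1 * e ^ n.+1).
    move=> lt_b le_C; apply: leq_trans (X'_size b lt_b) _.
    apply: (@leq_trans (#|C| * (n * e ^ n) * e)); first by rewrite leq_mul2r le_C orbT.
    rewrite -mulnA leq_mul2l; apply/orP; right.
    by rewrite expnS -mulnA (mulnC e) leq_mul.
  by case/andP: lt_ij => lt_ij lt_jn; split; apply: bound => //; apply: ltn_trans lt_jn.
(* Otherwise [X 0] is covered by [n] sets, one for each later set; one of them has a [1 / n] share
   of [X 0] and is sparse towards the whole of its later set. *)
have bad_all v : v \in X 0 -> exists b : 'I_n, bad v b.
  move=> vX; apply/existsP; rewrite -[X in is_true X]negbK negb_exists.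
  by apply: contra no_good => ?; apply/existsP; exists v; rewrite vX.
pose A (b : 'I_n) := [set v in X 0 | bad v b].
have le_sum : #|X 0| <= \sum_(b < n) #|A b|.
  under eq_bigr do rewrite card_filter; rewrite exchange_big /= -sum1_card.
  apply: leq_sum => v /bad_all[b bad_b].
  by rewrite (bigD1 b) //= bad_b.
have [b le_b] : exists b, #|X 0| <= #|A b| * n.
  apply/existsP; rewrite -[X in is_true X]negbK negb_exists.
  apply/negP=> /forallP lt_b; have X0_gt0 := X_gt0 0 (ltn0Sn n).
  have n_gt0 : 0 < n by have [u /bad_all[[] //]] := card_gt0P X0_gt0; case: (n).
  have : (\sum_(b < n) #|A b|) * n < n * #|X 0|.
    rewrite big_distrl /= -[n in n * _]card_ord -sum_nat_const.
    have i0 := Ordinal n_gt0.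
    rewrite (bigD1 i0) //= [ltnRHS](bigD1 i0) //= -addSn leq_add //.
      by rewrite ltnNge.
    by apply: leq_sum => i _; apply/ltnW; rewrite ltnNge.
  by nia.
right; exists 0, b.+1, (A b), (X b.+1); split=> //.
- exact: ltn_ord.
- by apply/subsetP=> v; rewrite inE => /andP[].
- have := e_exp n.+1; split; last by nia.
  by apply: leq_trans le_b _; nia.
- by move=> v; rewrite inE => /andP[].
Qed.

End Counting.

(** * Families of pairwise sparse sets *)

Section LowDegree.
Variable T : finType.
Implicit Types (R : rel T) (A B X Y : {set T}) (Xs : seq {set T}).

Lemma low_degree_side R A B e : 0 < #|B| -> edg R A B * e <= 2 * (#|A| * #|B|) ->
  #|A| <= 2 * #|[set v in A | deg R v B * e <= 4 * #|B| ]|.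
Proof.
move=> B_gt0 le_e; apply: markov_half; first by rewrite muln_gt0.
by rewrite -big_distrl -/(edg R A B) /=; nia.
Qed.

(** A union bound: the threshold for each [X] is [2 * n] times the bound on the mean, so a share of
    at most [1 / (2n)] of [B] violates it, and at most half of [B] violates some threshold. *)
Lemma low_degree_family R B e n Xs : 0 < n -> size Xs <= n ->
  all (fun X => (0 < #|X|) && (edg R X B * e <= 4 * (#|X| * #|B|))) Xs ->
  #|B| <= 2 * #|[set w in B | all (fun X =>
      #|[set v in X | R v w]| * e <= 8 * n * #|X|) Xs]|.
Proof.
move=> n_gt0 le_Xs sparse_Xs.
pose low w := all (fun X => #|[set v in X | R v w]| * e <= 8 * n * #|X|) Xs.
rewrite (_ : [set w in B | _] = [set w in B | low w]) //.
suff le_bad : 2 * n * #|[set w in B | ~~ low w]| <= size Xs * #|B|.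
  by have := card_filterC B low; nia.
rewrite {}/low; elim: Xs sparse_Xs {le_Xs} => [_|X Xs IHXs] /=.
  by rewrite eq_card0 ?muln0 // => w; rewrite !inE andbF.
case/andP=> /andP[X_gt0 le_X] /IHXs le_bad; rewrite mulSn.
apply: leq_trans (leq_add _ le_bad); last exact: leqnn.
set f := fun w => #|[set v in X | R v w]| * e.
have le_bad_X : 2 * n * #|[set w in B | 8 * n * #|X| < f w]| <= #|B|.
  have := markov_count B f (8 * n * #|X|).
  by rewrite -big_distrl -edgC /=; nia.
apply: (@leq_trans (2 * n * (#|[set w in B | 8 * n * #|X| < f w]| +
  #|[set w in B | ~~ all (fun X => #|[set v in X | R v w]| * e <= 8 * n * #|X|) Xs]|))).
  rewrite leq_mul2l; apply/orP; right.
  apply: leq_trans (leq_card_setU _ _); apply/subset_leq_card/subsetP=> w.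
  by rewrite !inE negb_and -ltnNge => /andP[-> /orP[-> | ->]]; rewrite ?orbT.
by rewrite mulnDr leq_add2r.
Qed.

End LowDegree.

Section SparseSets.
Variables (T : finType) (lam col : T -> T -> nat).
Variables (n D d : nat) (pat : nat -> nat -> nat -> nat).
Implicit Types (A B W X Y : {set T}) (Xs : seq {set T}).

(* (L, c) encodes the block of labels l with l %/ L = c; the block (d * L, c)
   splits into the d blocks (L, c * d + y) with y < d. *)
Definition low_color k L c : rel T :=
  fun v w => [&& v != w, col v w < k & lam v w %/ L == c].

Definition pattern_edge k L c i j : rel T :=
  fun v w => [&& v != w, col v w == k & lam v w %/ L == c * d + pat k i j].

(** Every block is covered, so the same hypothesis serves after each refinement. Distinctness of the
    vertices is part of [pattern_edge]. *)
Definition pattern_free k := forall L c (v : nat -> T),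
  ~ (forall i j, i < j < n -> pattern_edge k L c i j (v i) (v j)).

Definition sparse_family k L c g Xs :=
  pairwise (fun X Y => edg (low_color k L c) X Y * g <= #|X| * #|Y|) Xs.

(** A binary tree with [n] leaves has [n.-1] inner nodes; each spends [num_digits k'] digits on a
    family for the lower colours and one more on the pattern of colour [k']. *)
Fixpoint num_digits k := if k is k'.+1 then n.-1 * (num_digits k').+1 else 0.

(* From a set of size at least 2 ^ (loss_exp k G) * t one finds sets of size t of
   density 2 ^ - G.  A tree node needs pairs of density 2 ^ - E, costing 2 ^ rho
   in greedy_or_sparse, inside a family for the k' lower colours. *)
Fixpoint loss_exp k G := if k is k'.+1 then
    let E := 3 + D + G in let rho := D + n * E in
    D * (1 + rho + loss_exp k' (E + 2 * rho))
  else 0.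

(** Refining a block only removes edges, so sparseness established earlier survives. *)
Lemma low_color_block k j a c :
  subrel (low_color k (d ^ j) c) (low_color k (d ^ (j + a)) (c %/ d ^ a)).
Proof.
move=> v w /and3P[v_w col_w /eqP lam_w].
by rewrite /low_color v_w col_w -lam_w expnD divnMA eqxx.
Qed.

(** Colour [k] is counted in the subblock only, the lower colours generously in the whole parent
    block, where they are already known to be sparse. *)
Lemma edg_color_split k L c1 y A B : y < d ->
  edg (low_color k.+1 L (c1 * d + y)) A B <=
  edg (fun v w => [&& v != w, col v w == k & lam v w %/ L == c1 * d + y]) A B
  + edg (low_color k (d * L) c1) A B.
Proof.
move=> lt_y; rewrite /edg -big_split /=; apply: leq_sum => v _.
rewrite /deg !card_filter -big_split /=; apply: leq_sum => w _.
rewrite /low_color ltnS.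
have block : lam v w %/ L == c1 * d + y -> lam v w %/ (d * L) == c1.
  move=> /eqP lam_vw; rewrite mulnC divnMA lam_vw.
  by rewrite divnMDl ?divn_small ?addn0 ?eqxx //; case: (d) lt_y.
case: (v != w) => //=; case: (lam v w %/ L == _) block => [block|_] //=.
  rewrite (block isT) andbT !andbT.
  by lia.
by rewrite !andbF.
Qed.

(** One inner node of the tree. Within a family sparse in the colours below [k], the greedy
    embedding of pattern [k] must fail, and its failure yields the pair. *)
Lemma sparse_pair k G W t j c : 0 < n -> n <= 2 ^ D ->
    (forall k a b, pat k a b < d) -> pattern_free k -> 0 < t ->
  (forall W t j c, 0 < t -> 2 ^ loss_exp k (3 + D + G + 2 * (D + n * (3 + D + G))) * t <= #|W| ->
     exists Xs c', [/\ size Xs = n, all (fun X => (X \subset W) && (t <= #|X|)) Xs,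
       c' %/ d ^ num_digits k = c &
       sparse_family k (d ^ j) c' (2 ^ (3 + D + G + 2 * (D + n * (3 + D + G)))) Xs]) ->
  2 ^ (D + n * (3 + D + G) + loss_exp k (3 + D + G + 2 * (D + n * (3 + D + G)))) * t <= #|W| ->
  exists A B c', [/\ A \subset W /\ B \subset W, t <= #|A| /\ t <= #|B|,
     c' %/ d ^ (num_digits k).+1 = c &
     edg (low_color k.+1 (d ^ j) c') A B * 2 ^ (3 + D + G) <= 2 * (#|A| * #|B|)].
Proof.
move=> n_gt0 le_n lt_pat free_k t_gt0 IHk.
set E := 3 + D + G; set rho := D + n * E; set G' := E + 2 * rho => le_W.
have t'_gt0 : 0 < 2 ^ rho * t by rewrite muln_gt0 expn_gt0.
(* The scale [j.+1] leaves one digit for the pattern; the extra factor [2 ^ rho] in the size pays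
   for the greedy argument. *)
have [|Xs [c1 [size_Xs all_Xs c1_c sparse_Xs]]] := IHk W _ j.+1 c t'_gt0.
  by rewrite mulnA -expnD addnC.
have inX i : i < n -> nth set0 Xs i \subset W /\ 2 ^ rho * t <= #|nth set0 Xs i|.
  by move=> lt_i; apply/andP; apply: (allP all_Xs); rewrite mem_nth ?size_Xs.
have X_gt0 i : i < n -> 0 < #|nth set0 Xs i|.
  by move=> /inX[_ /(leq_trans t'_gt0)].
have [x0 _] := card_gt0P (X_gt0 0 n_gt0).
have E_gt0 : 0 < 2 ^ E by rewrite expn_gt0.
have [[v [_ v_pat]] | [i [i' [A [B [lt_ii' sA sB [cA cB] deg_le]]]]]] :=
  greedy_or_sparse x0 E_gt0 (fun a b => pattern_edge k (d ^ j) c1 a b) X_gt0.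
  by case: (free_k (d ^ j) c1 v).
have [lt_i lt_i'] : i < n /\ i' < n by lia.
have le_r : n * (2 ^ E) ^ n <= 2 ^ rho.
  by rewrite -expnM mulnC /rho expnD (mulnC n E) mulnC leq_mul.
have rho_gt0 : 0 < 2 ^ rho by rewrite expn_gt0.
have {}cA : #|nth set0 Xs i| <= #|A| * 2 ^ rho by apply: leq_trans cA _; rewrite leq_mul2l le_r orbT.
have {}cB : #|nth set0 Xs i'| <= #|B| * 2 ^ rho by apply: leq_trans cB _; rewrite leq_mul2l le_r orbT.
have [sX cX] := inX i lt_i; have [sX' cX'] := inX i' lt_i'.
exists A, B, (c1 * d + pat k i i'); split.
- by split; apply: subset_trans; eassumption.
- have : 2 ^ rho * t <= 2 ^ rho * #|A| by apply: leq_trans cX _; rewrite mulnC.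
  have : 2 ^ rho * t <= 2 ^ rho * #|B| by apply: leq_trans cX' _; rewrite mulnC.
  by rewrite !leq_pmul2l.
- have d_gt0 : 0 < d by apply: leq_ltn_trans (lt_pat k i i').
  by rewrite expnS divnMA divnMDl // (divn_small (lt_pat k i i')) addn0.
have le1 : edg (pattern_edge k (d ^ j) c1 i i') A B * 2 ^ E <= #|A| * #|B|.
  rewrite /edg big_distrl /= -sum_nat_const; exact: leq_sum.
have le2 : edg (low_color k (d ^ j.+1) c1) A B * 2 ^ E <= #|A| * #|B|.
  have /(pairwiseP set0) := sparse_Xs.
  move=> /(_ i i'); rewrite !inE size_Xs => /(_ lt_i lt_i').
  have /andP[-> _] := lt_ii'; move=> /(_ isT) le_X.
  (* Passing to [A] and [B] multiplies the density by at most [2 ^ rho] for each side; [G'] exceeds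
     [E] by exactly [2 * rho]. *)
  have le_edg : edg (low_color k (d ^ j.+1) c1) A B * 2 ^ G' <= #|A| * 2 ^ rho * (#|B| * 2 ^ rho).
    apply: leq_trans (leq_mul cA cB); apply: leq_trans le_X.
    by rewrite leq_mul2r edg_sub ?orbT.
  rewrite -(leq_pmul2r (_ : 0 < 2 ^ rho * 2 ^ rho)); last by rewrite muln_gt0 rho_gt0.
  apply: leq_trans (_ : edg (low_color k (d ^ j.+1) c1) A B * 2 ^ G' <= _).
    by rewrite [2 ^ G']expnD mul2n -addnn expnD !mulnA.
  by apply: leq_trans le_edg _; nia.
have := edg_color_split k (d ^ j) c1 A B (lt_pat k i i').
rewrite -expnS -/(pattern_edge k (d ^ j) c1 i i') => le_split.
rewrite mul2n -addnn; apply: leq_trans (leq_add le1 le2).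
by rewrite -mulnDl leq_mul2r le_split orbT.
Qed.

(** Induction on the depth [p], with [s] leaves below the node. The left subtree grows in the
    low-degree part of [A], and only then is [B] pruned against the sets found there. *)
Lemma sparse_tree k G : 0 < n -> n <= 2 ^ D ->
    (forall k a b, pat k a b < d) -> pattern_free k ->
    let G' := 3 + D + G + 2 * (D + n * (3 + D + G)) in
    (forall W t j c, 0 < t -> 2 ^ loss_exp k G' * t <= #|W| ->
     exists Xs c', [/\ size Xs = n, all (fun X => (X \subset W) && (t <= #|X|)) Xs,
       c' %/ d ^ num_digits k = c & sparse_family k (d ^ j) c' (2 ^ G') Xs]) ->
  forall p s W t j c, 0 < s <= 2 ^ p -> s <= n -> 0 < t ->
    2 ^ (p * (1 + (D + n * (3 + D + G)) + loss_exp k G')) * t <= #|W| ->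
  exists Xs c', [/\ size Xs = s, all (fun X => (X \subset W) && (t <= #|X|)) Xs,
       c' %/ d ^ (s.-1 * (num_digits k).+1) = c &
       sparse_family k.+1 (d ^ j) c' (2 ^ G) Xs].
Proof.
move=> n_gt0 le_n lt_pat free_k G' IHk.
set beta := 1 + _ + _; elim=> [|p IHp] s W t j c /andP[s_gt0 le_s] le_sn t_gt0 le_W.
(* A single leaf needs neither a pair nor a digit; for [p = 0] no other case is possible. *)
all: have [s1|s_neq1] := eqVneq s 1; [exists [:: W], c; rewrite s1 mul0n expn0 divn1; split=> //=;
  rewrite subxx andbT /=; apply: leq_trans le_W; rewrite -{1}[t]mul1n leq_mul2r expn_gt0 orbT //|].
  by lia.
have [s1 [s2 [/andP[s1_gt0 s2_gt0] eq_s /andP[le_s1 le_s2] /andP[le_s1n le_s2n]]]] :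
    exists s1 s2, [/\ (0 < s1) && (0 < s2), s1 + s2 = s,
      (s1 <= 2 ^ p) && (s2 <= 2 ^ p) & (s1 <= n) && (s2 <= n)].
  exists s./2, (uphalf s); rewrite uphalf_half; rewrite expnS in le_s.
  move: (2 ^ p) s_gt0 s_neq1 le_s le_sn (odd_double_half s) => P; clear.
  by case: (odd s) => /= *; split; lia.
pose delta := (num_digits k).+1.
(* The factor 2 allows for the halving of [A] and of [B] by the two prunings. *)
have t1_gt0 : 0 < 2 * (2 ^ (p * beta) * t) by rewrite !muln_gt0 expn_gt0.
(* The pair is sought at a scale that keeps in reserve [delta] digits for each inner node of both
   subtrees. *)
have [|A [B [c1 [[sA sB] [cA cB] c1_c le_edg]]]] :=
    @sparse_pair k G W _ (j + s2.-1 * delta + s1.-1 * delta) c n_gt0 le_n lt_pat free_k t1_gt0 IHk.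
  apply: leq_trans le_W; rewrite !mulnA -/G'; apply: leq_mul => //.
  by rewrite -expnSr -expnD mulSn leq_exp2l // addSn.
set E := 3 + D + G in le_edg.
have B_gt0 : 0 < #|B| by apply: leq_trans cB.
set R := low_color _ _ _ in le_edg.
pose A' := [set v in A | deg R v B * 2 ^ E <= 4 * #|B| ].
have sA' : A' \subset A by apply/subsetP=> v; rewrite inE => /andP[].
have cA' : 2 ^ (p * beta) * t <= #|A'|.
  by rewrite -(leq_pmul2l (_ : 0 < 2)) //; apply: leq_trans cA (low_degree_side B_gt0 le_edg).
have [||Xs [c2 [size_Xs all_Xs c2_c1 sparse_Xs]]] :=
    IHp s1 A' t (j + s2.-1 * delta) c1 _ _ t_gt0 cA'; [by rewrite s1_gt0|exact: le_s1n|].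
pose B' := [set w in B | all (fun X => #|[set v in X | R v w]| * 2 ^ E <= 8 * n * #|X|) Xs].
have sB' : B' \subset B by apply/subsetP=> v; rewrite inE => /andP[].
have cB' : 2 ^ (p * beta) * t <= #|B'|.
  rewrite -(leq_pmul2l (_ : 0 < 2)) //; apply: leq_trans cB _.
  apply: low_degree_family => //; first by rewrite size_Xs.
  apply/allP=> X /(allP all_Xs)/andP[sX cX]; rewrite (leq_trans t_gt0 cX) /=.
  rewrite /edg big_distrl /= mulnCA -sum_nat_const; apply: leq_sum => v vX.
  by have := subsetP sX v vX; rewrite inE => /andP[].
have [||Ys [c3 [size_Ys all_Ys c3_c2 sparse_Ys]]] :=
    IHp s2 B' t j c2 _ _ t_gt0 cB'; [by rewrite s2_gt0|exact: le_s2n|].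
exists (Xs ++ Ys), c3; split.
- by rewrite size_cat size_Xs size_Ys.
- rewrite all_cat; apply/andP; split.
    apply: sub_all all_Xs => X /andP[sX ->]; rewrite andbT.
    exact: subset_trans sX (subset_trans sA' sA).
  apply: sub_all all_Ys => X /andP[sX ->]; rewrite andbT.
  exact: subset_trans sX (subset_trans sB' sB).
- have -> : s.-1 = s2.-1 + s1.-1.+1.
    by rewrite -eq_s (prednK s1_gt0) addnC -[in LHS](prednK s2_gt0).
  by rewrite mulnDl mulSn (addnC _ (s1.-1 * _)) !expnD !divnMA c3_c2 c2_c1.
have sub32 : subrel (low_color k.+1 (d ^ j) c3) (low_color k.+1 (d ^ (j + s2.-1 * delta)) c2).
  by rewrite -c3_c2; apply: low_color_block.
have sub21 : subrel (low_color k.+1 (d ^ (j + s2.-1 * delta)) c2) R.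
  by rewrite /R -c2_c1; apply: low_color_block.
rewrite /sparse_family pairwise_cat; apply/and3P; split=> //.
  apply/allrelP=> X Y inXs /(allP all_Ys) /andP[sY cY].
  have le_XY : edg R X Y * 2 ^ E <= 8 * n * (#|X| * #|Y|).
    rewrite edgC big_distrl /= mulnA (mulnC _ #|Y|) -sum_nat_const.
    apply: leq_sum => w wY; have := subsetP sY w wY.
    by rewrite inE => /andP[_ /allP/(_ X inXs)].
  rewrite -(leq_pmul2l (_ : 0 < 8 * n)) ?muln_gt0 //; apply: leq_trans le_XY.
  rewrite mulnA (mulnC (8 * n)) -mulnA leq_mul //.
    by apply: edg_sub => // v w /sub32/sub21.
  (* The summand [3 + D] of [E] absorbs the factor [8 * n] of the pruning, since [n <= 2 ^ D]. *)
  by rewrite /E 2!expnD leq_mul2r leq_mul ?orbT.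
apply: sub_pairwise sparse_Xs => X Y; apply: leq_trans.
by rewrite leq_mul2r edg_sub ?orbT.
Qed.

Lemma sparse_sets k : 0 < n -> n <= 2 ^ D -> (forall k a b, pat k a b < d) ->
    (forall k', k' < k -> pattern_free k') ->
  forall G W t j c, 0 < t -> 2 ^ loss_exp k G * t <= #|W| ->
  exists Xs c', [/\ size Xs = n, all (fun X => (X \subset W) && (t <= #|X|)) Xs,
    c' %/ d ^ num_digits k = c & sparse_family k (d ^ j) c' (2 ^ G) Xs].
Proof.
move=> n_gt0 le_n lt_pat; elim: k => [|k IHk] free G W t j c t_gt0 le_W.
  exists (nseq n W), c; rewrite size_nseq divn1; split=> //.
    rewrite mul1n in le_W; apply/allP=> X /nseqP[-> _]; exact/andP.
  rewrite /sparse_family; apply/(pairwiseP set0) => a b _ _ _.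
  rewrite /edg big1 // => v _; apply/eqP; rewrite cards_eq0; apply/eqP/setP=> w.
  by rewrite !inE /low_color ltn0 !andbF.
have IHk' := IHk (fun k' lt_k' => free k' (ltnW lt_k')).
have n_bounds : 0 < n <= 2 ^ D by rewrite n_gt0.
exact: (sparse_tree n_gt0 le_n lt_pat (free k (ltnSn k)) (IHk' _) j c n_bounds (leqnn n) t_gt0 le_W).
Qed.

End SparseSets.

(** * Embedding the last colour *)

Section TypicalEmbedding.
Variables (T : finType) (lam : T -> T -> nat) (host : {set T}) (M s : nat).
Implicit Types (X Y Z : {set T}) (R : rel T).

Definition label_rel l : rel T := fun v w => lam v w == l.

(** A vertex is expected to have [#|X| / M] neighbours of a given label; a deviation by a factor of
    two either way is tolerated. *)
Definition typical l X v :=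
  (#|X| <= 2 * M * deg (label_rel l) v X) && (M * deg (label_rel l) v X <= 2 * #|X|).

Definition typical_labelling := forall l X, l < M -> X \subset host -> s <= #|X| ->
  #|[set v in host | ~~ typical l X v]| <= s.

Hypotheses (M_gt0 : 0 < M) (lamC : forall v w, lam v w = lam w v).
Hypothesis typ : typical_labelling.

Lemma atypical_leq l X Y : l < M -> X \subset host -> Y \subset host -> s <= #|X| ->
  #|[set v in Y | ~~ typical l X v]| <= s.
Proof.
move=> lt_l sX sY le_s; apply: leq_trans (typ lt_l sX le_s).
apply/subset_leq_card/subsetP=> v; rewrite !inE => /andP[/(subsetP sY)->].
by [].
Qed.

Lemma label_edg_leq l X Y : l < M -> X \subset host -> Y \subset host ->
  M * edg (label_rel l) X Y <= 2 * (#|X| * #|Y|) + s * M * (#|Y| + #|X|).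
Proof.
move=> lt_l sX sY; have [lt_s | le_s] := ltnP #|Y| s.
  have : edg (label_rel l) X Y <= #|X| * #|Y|.
    by rewrite -sum_nat_const; apply: leq_sum => v _; apply: deg_leq.
  by move=> le1; have : edg (label_rel l) X Y <= #|X| * s; nia.
have := @sum_split_leq _ X (typical l Y) (fun v => M * deg (label_rel l) v Y)
  (2 * #|Y|) (M * #|Y|) _ _.
rewrite -big_distrr /= => /(_ _ _)/leq_trans-> //.
- by move=> v _ /andP[].
- by move=> v _; rewrite leq_mul2l deg_leq orbT.
rewrite mulnCA leq_add2l mulnDr (leq_trans _ (leq_addr _ _)) // -mulnA.
by rewrite leq_mul // atypical_leq.
Qed.

(* Counted from u in X1, the sum is over the label-l2 edges between the
   l1-neighbours of u in X0 and the R-neighbours of u in X2. *)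
Lemma label_pairs_leq l1 l2 X0 X1 X2 R : l1 < M -> l2 < M ->
    X0 \subset host -> X1 \subset host -> X2 \subset host -> s <= #|X0| ->
  M ^ 2 * \sum_(v in X0) edg R [set u in X1 | label_rel l1 v u]
                               [set w in X2 | label_rel l2 v w]
  <= 4 * #|X0| * edg R X1 X2 + s * M ^ 2 * (3 * #|X0| * #|X2| + #|X1| * (#|X2| + #|X0|)).
Proof.
move=> lt1 lt2 s0 s1 s2 le_s.
pose S u := [set v in X0 | label_rel l1 u v]; pose Q u := [set w in X2 | R u w].
have -> : \sum_(v in X0) edg R [set u in X1 | label_rel l1 v u]
                               [set w in X2 | label_rel l2 v w]
   = \sum_(u in X1) edg (label_rel l2) (S u) (Q u).
  transitivity (\sum_(v in X0) \sum_(u in X1 | label_rel l1 v u)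
      deg (label_rel l2) v (Q u)).
    apply: eq_bigr => v _; rewrite /edg; apply: eq_big => u; first by rewrite inE.
    by move=> _; apply: eq_card => w; rewrite !inE andbAC.
  rewrite (exchange_big_dep (mem X1)) /=; last by move=> v u _ /andP[].
  apply: eq_bigr => u u1; apply: eq_bigl => v.
  by rewrite !inE u1 /label_rel lamC.
have le_edg u : u \in X1 -> M * edg (label_rel l2) (S u) (Q u) <=
    2 * (#|S u| * #|Q u|) + s * M * (#|X2| + #|X0|).
  move=> u1; have sS : S u \subset X0 by apply/subsetP=> v; rewrite inE => /andP[].
  have sQ : Q u \subset X2 by apply/subsetP=> v; rewrite inE => /andP[].
  apply: leq_trans (label_edg_leq lt2 (subset_trans sS s0) (subset_trans sQ s2)) _.
  by rewrite leq_add2l leq_mul2l leq_add ?subset_leq_card ?orbT.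
have le_SQ : M * \sum_(u in X1) #|S u| * #|Q u| <= 2 * #|X0| * edg R X1 X2 + s * M * (#|X0| * #|X2|).
  (* A typical [u] has at most [2 * #|X0| / M] neighbours in [S u]; the at most [s] others are
     bounded trivially. *)
  have le_S u : u \in X1 -> M * (#|S u| * #|Q u|) <= 2 * #|X0| * #|Q u| +
     (~~ typical l1 X0 u) * (M * (#|X0| * #|X2|)).
    move=> u1; case typ_u: (typical l1 X0 u); last first.
      rewrite mul1n (leq_trans _ (leq_addl _ _)) // leq_mul2l leq_mul ?orbT //.
        by rewrite deg_leq.
      by rewrite deg_leq.
    rewrite mul0n addn0 mulnA leq_mul2r; apply/orP; right.
    by case/andP: typ_u.
  rewrite big_distrr /=; apply: leq_trans (leq_sum _ _) _; first exact: le_S.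
  rewrite big_split -big_distrr -big_distrl -card_filter leq_add2l /=.
  by rewrite -(mulnA s) leq_mul // atypical_leq.
have : M * \sum_(u in X1) edg (label_rel l2) (S u) (Q u) <=
   2 * \sum_(u in X1) #|S u| * #|Q u| + #|X1| * (s * M * (#|X2| + #|X0|)).
  rewrite !big_distrr -sum_nat_const -big_split /=; exact: leq_sum.
set a := \sum_(u in X1) edg _ _ _; set b := \sum_(u in X1) _ in le_SQ *.
rewrite !expnS expn0 => le_a.
have : M * (M * a) <= M * (2 * b + #|X1| * (s * M * (#|X2| + #|X0|))).
  by rewrite leq_mul2l le_a orbT.
have : s * M <= s * (M * M) by nia.
nia.
Qed.

Lemma card_cover_leq (I : finType) (X : {set T}) (F : I -> pred T) a c :
    0 < c -> (forall i, #|[set v in X | F i v]| * (c * #|I|) <= a) ->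
  #|[set v in X | [exists i, F i v]]| * c <= a.
Proof.
move=> c_gt0 le_F.
have le_sum : #|[set v in X | [exists i, F i v]]| <= \sum_i #|[set v in X | F i v]|.
  have -> : \sum_i #|[set v in X | F i v]| = \sum_(v in X) \sum_i F i v.
    by rewrite exchange_big; apply: eq_bigr => i _; rewrite card_filter.
  rewrite card_filter; apply: leq_sum => v _.
  case: existsP => // -[i Fi]; by rewrite (bigD1 i) //= Fi.
have [I0 | I_gt0] := posnP #|I|.
  rewrite (leq_trans (leq_mul le_sum (leqnn _))) // big1 // => i.
  by have := max_card (pred1 i); rewrite card1 I0.
rewrite -(leq_pmul2r I_gt0) -mulnA.
apply: leq_trans (_ : (\sum_i #|[set v in X | F i v]|) * (c * #|I|) <= _).
  by rewrite leq_mul2r le_sum orbT.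
apply: leq_trans (_ : \sum_(i : I) a <= _); last by rewrite sum_nat_const mulnC.
by rewrite big_distrl; apply: leq_sum => i _.
Qed.

(** Three kinds of vertices of [X 0] are bad, each filling at most a quarter of it, so a good one
    remains. The [s] exceptional vertices are negligible because all sets have size at least
    [s * M ^ 2 * g1]. *)
Lemma embedding_step n n0 (X : nat -> {set T}) (l : nat -> nat) R g :
    0 < s -> 0 < n0 -> n <= n0 -> M <= g ->
    let g1 := 1024 * n0 ^ 2 * g in
    (forall i, i <= n -> X i \subset host /\ s * M ^ 2 * g1 <= #|X i|) ->
    (forall i, i < n -> l i < M) ->
    (forall i j, i < j <= n -> edg R (X i) (X j) * g1 <= #|X i| * #|X j|) ->
  exists2 v, v \in X 0 &
    let X' i := [set w in X i.+1 | label_rel (l i) v w && ~~ R v w] in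
    (forall i, i < n -> #|X i.+1| <= 4 * M * #|X' i|) /\
    (forall i j, i < j < n -> edg R (X' i) (X' j) * g <= #|X' i| * #|X' j|).
Proof.
move=> s_gt0 n0_gt0 le_n le_g g1 XP lt_l sparse.
have g_gt0 : 0 < g by apply: leq_trans le_g.
have M2_gt0 : 0 < M ^ 2 by rewrite expn_gt0 M_gt0.
have g1_gt0 : 0 < g1 by rewrite /g1 !muln_gt0 n0_gt0 g_gt0.
have X_gt0 i : i <= n -> 0 < #|X i|.
  by move=> /XP[_]; apply: leq_trans; rewrite !(muln_gt0, s_gt0, M_gt0, n0_gt0, g_gt0).
pose N i v := [set w in X i.+1 | label_rel (l i) v w].
pose bad1 (i : 'I_n) v := ~~ typical (l i) (X i.+1) v.
(* A typical vertex has at least [#|X| / (2 * M)] neighbours of the label; deleting at most half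
   that many leaves [#|X| / (4 * M)]. *)
pose bad2 (i : 'I_n) v := #|X i.+1| < deg R v (X i.+1) * (4 * M).
(* The constant in [g1] is [1024 = 64 * 4 ^ 2]: 64 from this threshold and a 4 from the shrinking of
   each of the two sets. *)
pose bad3 (ij : 'I_n * 'I_n) v := (ij.1 < ij.2) &&
  (64 * n0 ^ 2 * (#|X ij.1.+1| * #|X ij.2.+1|) < edg R (N ij.1 v) (N ij.2 v) * (M ^ 2 * g1)).
have s0 : X 0 \subset host by case: (XP 0).
have le_s i : i <= n -> s <= #|X i|.
  by move=> /XP[_]; apply: leq_trans; rewrite -mulnA leq_pmulr // muln_gt0 M2_gt0 g1_gt0.
have le_n02 : n <= n0 ^ 2 by rewrite -mulnn (leq_trans le_n) // leq_pmulr.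
have le_g1 : 4 * n <= g1.
  by rewrite /g1; move: (n0 ^ 2) le_n02 => m le_m; nia.
have le1 : #|[set v in X 0 | [exists i, bad1 i v]]| * 4 <= #|X 0|.
  apply: card_cover_leq => // i; rewrite card_ord.
  have [sX le_X] := XP i.+1 (ltn_ord i).
  have := atypical_leq (lt_l i (ltn_ord i)) sX s0 (le_s _ (ltn_ord i)).
  have [_ le_X0] := XP 0 isT; move=> le_a; apply: leq_trans le_X0.
  rewrite -mulnA; apply: leq_mul => //.
  by rewrite (leq_trans le_g1) // leq_pmull.
have le2 : #|[set v in X 0 | [exists i, bad2 i v]]| * 4 <= #|X 0|.
  apply: card_cover_leq => // i; rewrite card_ord.
  have := markov_count (X 0) (fun v => deg R v (X i.+1) * (4 * M)) #|X i.+1|.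
  rewrite -big_distrl -/(edg R (X 0) (X i.+1)) /=.
  have := sparse 0 i.+1 (ltn_ord i); have := X_gt0 _ (ltn_ord i).
  set c := #|[set v in X 0 | _]|; set x1 := #|X i.+1|; set e := edg _ _ _.
  move=> x1_gt0 le_e le_c.
  have : c * x1 * g1 <= 4 * M * (#|X 0| * x1).
    apply: leq_trans (_ : e * (4 * M) * g1 <= _); first by rewrite leq_mul2r le_c orbT.
    by rewrite mulnAC mulnC leq_mul2l le_e orbT.
  have -> : c * x1 * g1 = c * g1 * x1 by rewrite mulnAC.
  rewrite mulnA leq_pmul2r // => le_cg.
  rewrite -(leq_pmul2r (_ : 0 < 4 * M)); last by rewrite muln_gt0.
  rewrite (mulnC #|X 0|); apply: leq_trans le_cg; rewrite -mulnA leq_mul2l.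
  apply/orP; right.
  (* By [M <= g], the relation [R] is sparser than a single label, which makes deleting its
     neighbours affordable. *)
  have : n * M <= n0 ^ 2 * g by rewrite leq_mul.
  by rewrite /g1; move: (n0 ^ 2) => m; lia.
have le3 : #|[set v in X 0 | [exists ij, bad3 ij v]]| * 4 <= #|X 0|.
  apply: card_cover_leq => // -[i j]; rewrite card_prod !card_ord.
  have [lt_ij|le_ji] := boolP (i < j); last first.
    by rewrite eq_card0 // => v; rewrite !inE /bad3 /= (negbTE le_ji) /= andbF.
  have [[s1 le_X1] [s2 le_X2]] := (XP i.+1 (ltn_ord i), XP j.+1 (ltn_ord j)).
  have [_ le_X0] := XP 0 isT.
  have := label_pairs_leq R (lt_l i (ltn_ord i)) (lt_l j (ltn_ord j)) s0 s1 s2 (le_s 0 isT).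
  have := sparse i.+1 j.+1 _; rewrite ltnS lt_ij ltn_ord => /(_ isT).
  have := markov_count (X 0) (fun v => edg R (N i v) (N j v) * (M ^ 2 * g1))
    (64 * n0 ^ 2 * (#|X i.+1| * #|X j.+1|)).
  rewrite -big_distrl /=.
  set c := #|[set v in X 0 | _]|; set Z := \sum_(v in X 0) _.
  have -> : #|[set v in X 0 | bad3 (i, j) v]| = c.
    by apply: eq_card => v; rewrite !inE /bad3 /= lt_ij.
  have := X_gt0 _ (ltn_ord i); have := X_gt0 _ (ltn_ord j).
  move: le_X0 le_X1 le_X2; set e := edg _ _ _; set m := M ^ 2.
  set x0 := #|X 0|; set x1 := #|X i.+1|; set x2 := #|X j.+1|.
  move=> le_X0 le_X1 le_X2 x2_gt0 x1_gt0 le_c le_e le_Z.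
  (* Here [9 = 4 + 3 + 1 + 1]: the main term and the three error terms, in each of which
     [s * m * g1] is bounded by one of the sizes. *)
  have le9 : Z * (m * g1) <= 9 * (x0 * x1 * x2).
    have -> : Z * (m * g1) = m * Z * g1 by rewrite mulnCA mulnA.
    apply: leq_trans (leq_mul le_Z (leqnn g1)) _; rewrite mulnDl.
    have -> : 9 * (x0 * x1 * x2) = 4 * x0 * (x1 * x2) +
      (3 * (x0 * x1 * x2) + (x0 * x1 * x2 + x0 * x1 * x2)) by lia.
    apply: leq_add; first by rewrite -(mulnA (4 * x0)) leq_mul.
    have -> : s * m * (3 * x0 * x2 + x1 * (x2 + x0)) * g1 =
      3 * (x0 * (s * m * g1) * x2) + (s * m * g1 * x1 * x2 + x0 * x1 * (s * m * g1)) by lia.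
    by rewrite !(leq_add, leq_mul).
  have : c * (64 * n0 ^ 2) * (x1 * x2) <= 9 * x0 * (x1 * x2).
    rewrite -mulnA; apply: leq_trans le_c _; apply: leq_trans le9 _.
    by rewrite !mulnA.
  rewrite leq_pmul2r ?muln_gt0 ?x1_gt0 // => le_c9.
  have : n * n <= n0 ^ 2 by rewrite -mulnn leq_mul.
  by nia.
have [v vX /norP[/norP[good1 good2] good3]] : exists2 v, v \in X 0 &
    ~~ ([exists i, bad1 i v] || [exists i, bad2 i v] || [exists ij, bad3 ij v]).
  apply/exists_inP; rewrite -[X in is_true X]negbK negb_exists_in.
  apply/negP=> /forall_inP all_bad.
  have : #|X 0| <= #|[set v in X 0 | [exists i, bad1 i v]]| +
     #|[set v in X 0 | [exists i, bad2 i v]]| + #|[set v in X 0 | [exists ij, bad3 ij v]]|.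
    rewrite !card_filter -!big_split /= -sum1_card; apply: leq_sum => v vX.
    by have := all_bad v vX; rewrite negbK; do !case: [exists _, _].
  by have := X_gt0 0 isT; lia.
exists v => // X'.
have sX' i : X' i \subset N i v.
  by apply/subsetP=> w; rewrite !inE => /and3P[-> ->].
have le_X' i : i < n -> #|X i.+1| <= 4 * M * #|X' i|.
  move=> lt_i; have := good1; rewrite negb_exists => /forallP/(_ (Ordinal lt_i)).
  rewrite negbK => /andP[/= le_N _].
  have := good2; rewrite negb_exists => /forallP/(_ (Ordinal lt_i)).
  rewrite -leqNgt /= => le_R.
  have : deg (label_rel (l i)) v (X i.+1) <= #|X' i| + deg R v (X i.+1).
    apply: leq_trans (leq_card_setU _ _); apply/subset_leq_card/subsetP=> w.
    by rewrite !inE => /andP[-> ->]; case: (R v w).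
  by nia.
split=> // i j /andP[lt_ij lt_j]; have lt_i := ltn_trans lt_ij lt_j.
have := good3; rewrite negb_exists => /forallP/(_ (Ordinal lt_i, Ordinal lt_j)).
rewrite /bad3 /= lt_ij /= -leqNgt => le_e.
have le_e' : edg R (X' i) (X' j) <= edg R (N i v) (N j v) by apply: edg_sub.
have := leq_mul (le_X' i lt_i) (le_X' j lt_j).
move: le_e le_e'; set e := edg _ _ _; set e' := edg _ _ _.
set x1 := #|X i.+1|; set x2 := #|X j.+1|; set y1 := #|X' i|; set y2 := #|X' j|.
move=> le_e le_e' le_xy.
have : e' * (M ^ 2 * g1) <= 64 * n0 ^ 2 * (4 * M * y1 * (4 * M * y2)).
  apply: leq_trans (leq_trans _ le_e) _; first by rewrite leq_mul2r le_e' orbT.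
  by rewrite leq_mul2l le_xy orbT.
have -> : e' * (M ^ 2 * g1) = (1024 * n0 ^ 2 * M ^ 2) * (e' * g) by rewrite /g1; lia.
have -> : 64 * n0 ^ 2 * (4 * M * y1 * (4 * M * y2)) = (1024 * n0 ^ 2 * M ^ 2) * (y1 * y2).
  by rewrite -[M ^ 2]mulnn; lia.
by rewrite leq_pmul2l // !muln_gt0 M_gt0 n0_gt0.
Qed.

(** [n0] stays fixed while [n] decreases, so each step costs the same factor [1024 * n0 ^ 2] in
    density and [4 * M] in size. The sizes never fall below [sigma] while a step remains to be
    made. *)
Lemma typical_embedding (x0 : T) n n0 (X : nat -> {set T}) (L : nat -> nat -> nat) R g sigma :
    0 < s -> 0 < n0 -> n <= n0 -> M <= g ->
    s * M ^ 2 * ((1024 * n0 ^ 2) ^ n0 * g) <= sigma ->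
    (forall i, i < n -> X i \subset host /\ (4 * M) ^ n * sigma <= #|X i|) ->
    (forall i j, i < j < n -> L i j < M) ->
    (forall i j, i < j < n ->
       edg R (X i) (X j) * ((1024 * n0 ^ 2) ^ n * g) <= #|X i| * #|X j|) ->
  exists v : nat -> T, (forall i, i < n -> v i \in X i) /\
    forall i j, i < j < n -> lam (v i) (v j) = L i j /\ ~~ R (v i) (v j).
Proof.
move=> s_gt0 n0_gt0 le_n le_g le_sigma; set K := 1024 * n0 ^ 2.
have K_gt0 : 0 < K by rewrite /K !(muln_gt0, n0_gt0).
have M4_gt0 : 0 < 4 * M by rewrite muln_gt0.
elim: n le_n X L => [|n IHn] le_n X L XP lt_L sparse.
  by exists (fun=> x0); split=> // i j; rewrite ltn0 andbF.
have le_gn : M <= K ^ n * g by rewrite (leq_trans le_g) // leq_pmull // expn_gt0 K_gt0.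
have [] := @embedding_step n n0 X (fun i => L 0 i.+1) R (K ^ n * g) s_gt0 n0_gt0 (ltnW le_n) le_gn.
- move=> i lt_i; have [sX le_X] := XP i lt_i; split=> //.
  apply: leq_trans le_X; apply: leq_trans (_ : sigma <= _); last first.
    by rewrite leq_pmull // expn_gt0 M4_gt0.
  apply: leq_trans le_sigma; rewrite leq_mul2l; apply/orP; right.
  by rewrite -/K (mulnA K) -expnS leq_mul2r leq_pexp2l ?orbT.
- by move=> i lt_i; apply: lt_L.
- by move=> i j lt_ij; rewrite -/K (mulnA K) -expnS; apply: sparse.
move=> v vX; set X' := fun i => [set w in X i.+1 | _] => /= -[le_X' sparse'].
have [i lt_i||u [uX uL]] := IHn (ltnW le_n) X' (fun i j => L i.+1 j.+1) _ _ sparse'.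
- have [sX le_X] := XP i.+1 lt_i; split.
    by apply: subset_trans sX; apply/subsetP=> w; rewrite inE => /andP[].
  by rewrite -(leq_pmul2l M4_gt0) mulnA -expnS; apply: leq_trans le_X (le_X' i lt_i).
- by move=> i j lt_ij; apply: lt_L.
exists (fun i => if i is i'.+1 then u i' else v); split.
  by case=> // i lt_i; have := uX i lt_i; rewrite inE => /andP[].
case=> [|i] [|j] //= lt_ij; last exact: uL.
by have := uX j lt_ij; rewrite inE => /and3P[_ /eqP].
Qed.

End TypicalEmbedding.

(** * The dot product as a labelling *)

(** A translation maps any fibre injectively into any other, so all fibres have the same size. *)
Lemma card_fiber (V : finZmodType) (Q : finType) (phi : V -> Q) :
    (forall q q', exists u, forall v, phi v = q -> phi (u + v)%R = q') ->
  forall q, #|[set v | phi v == q]| * #|Q| = #|V|.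
Proof.
move=> shift q.
have le_fiber q1 q2 : #|[set v | phi v == q1]| <= #|[set v | phi v == q2]|.
  have [u uP] := shift q1 q2.
  rewrite -(card_imset _ (addrI u)); apply/subset_leq_card/subsetP=> _ /imsetP[v + ->].
  by rewrite !inE => /eqP/uP->.
rewrite -[RHS]sum1_card (partition_big phi xpredT) //= mulnC -sum_nat_const.
apply: eq_bigr => q' _; rewrite sum1dep_card.
by apply/eqP; rewrite eqn_leq !le_fiber.
Qed.

Section DotProduct.
Variables (F : finFieldType) (h : nat).
Local Notation V := 'rV[F]_h.
Implicit Types (u v w : V) (X : {set V}).
Local Open Scope ring_scope.

Definition dot v w : F := \sum_i v 0 i * w 0 i.

Lemma dotC v w : dot v w = dot w v.
Proof. by apply: eq_bigr => i _; rewrite mulrC. Qed.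

Lemma dotDl u v w : dot (u + v) w = dot u w + dot v w.
Proof. by rewrite /dot -big_split /=; apply: eq_bigr => i _; rewrite mxE mulrDl. Qed.

Lemma dotZl a v w : dot (a *: v) w = a * dot v w.
Proof. by rewrite /dot big_distrr /=; apply: eq_bigr => i _; rewrite mxE mulrA. Qed.

Lemma dot_delta i w : dot (delta_mx 0 i) w = w 0 i.
Proof.
rewrite /dot (bigD1 i) //= mxE !eqxx mul1r big1 ?addr0 // => j /negbTE neq_j.
by rewrite mxE neq_j mul0r.
Qed.

Lemma dot_unit w : w != 0 -> exists u, dot u w = 1.
Proof.
case/rV0Pn=> i wi; exists ((w 0 i)^-1 *: delta_mx 0 i).
by rewrite dotZl dot_delta mulVf.
Qed.

Lemma dot_separate w w' : w != 0 -> (forall c, w' != c *: w) ->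
  exists u, dot u w = 0 /\ dot u w' = 1.
Proof.
move=> /[dup] w_neq0 /rV0Pn[i wi] indep.
have : w' - (w' 0 i / w 0 i) *: w != 0 by rewrite subr_eq0.
case/rV0Pn=> j; rewrite !mxE => wj.
set c := w' 0 j - _ in wj.
(* The combination of two unit vectors orthogonal to [w], scaled by its product with [w'], which is
   nonzero by the choice of [j]. *)
exists (c^-1 *: (delta_mx 0 j - (w 0 j / w 0 i) *: delta_mx 0 i)).
rewrite !dotZl !dotDl -!scaleNr !dotZl !dot_delta; split.
  by rewrite mulNr divfK // subrr mulr0.
by rewrite -[RHS](mulVf wj); congr (_ * _); rewrite /c; field.
Qed.

Lemma card_dot w l : w != 0 -> (#|[set v | dot v w == l]| * #|F| = #|V|)%N.
Proof.
case/dot_unit=> u u1; apply: card_fiber => q q'; exists ((q' - q) *: u) => v vq.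
by rewrite dotDl dotZl u1 mulr1 vq subrK.
Qed.

(** Pairwise independence: [t] adjusts the product with [w], then [u], orthogonal to [w], adjusts
    the one with [w']. *)
Lemma card_dot2 w w' l : w != 0 -> (forall c, w' != c *: w) ->
  (#|[set v | (dot v w == l) && (dot v w' == l)]| * #|F| ^ 2 = #|V|)%N.
Proof.
move=> w_neq0 indep; have [u [u0 u1]] := dot_separate w_neq0 indep.
have [t t1] := dot_unit w_neq0.
rewrite -mulnn -card_prod -(card_fiber (phi := fun v => (dot v w, dot v w')) _ (l, l)) //.
move=> [q1 q2] [r1 r2].
exists ((r1 - q1) *: t + (r2 - q2 - (r1 - q1) * dot t w') *: u) => v [vq1 vq2].
by rewrite !dotDl !dotZl t1 u0 u1 vq1 vq2; congr (_, _); ring.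
Qed.

Lemma card_multiples_leq w X : (#|[set w' in X | [exists c, w' == c *: w]]| <= #|F|)%N.
Proof.
rewrite -[leqRHS]cardsT; apply: leq_trans (leq_imset_card (fun c => c *: w) _).
apply/subset_leq_card/subsetP=> w'; rewrite inE => /andP[_ /existsP[c /eqP->]].
by apply/imsetP; exists c; rewrite ?inE.
Qed.

(** Chebyshev's inequality for the number of [w] in [X] with [dot v w = l], over a uniform [v]. The
    zero vector is excluded since its products do not vary. *)
Lemma dot_typical l X s : X \subset [set~ 0%R] -> (s <= #|X|)%N -> (0 < s)%N ->
    (4 * #|F| ^ 2 * #|V| <= s ^ 2)%N ->
  (#|[set v | ~~ ((#|X| <= 2 * #|F| * #|[set w in X | dot v w == l]|) &&
                 (#|F| * #|[set w in X | dot v w == l]| <= 2 * #|X|))]| <= s)%N.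
Proof.
move=> X_neq0 le_sX s_gt0 le_s.
set f := fun v => #|[set w in X | dot v w == l]|; set Ex := [set v | _].
set x := #|X| in le_sX *; set M := #|F| in le_s *; set N := #|V| in le_s *.
have wn0 w : w \in X -> w != 0 by move/(subsetP X_neq0); rewrite !inE.
have sum1 : (M * \sum_v f v = x * N)%N.
  rewrite /f; under eq_bigr do rewrite card_filter.
  rewrite exchange_big /= big_distrr -sum_nat_const; apply: eq_bigr => w wX /=.
  rewrite /N -(card_dot l (wn0 w wX)) mulnC -/M; congr (_ * _)%N.
  by rewrite -sum1dep_card [RHS]big_mkcond; apply: eq_bigr.
have sum2 : (M ^ 2 * \sum_v f v ^ 2 <= x ^ 2 * N + M ^ 2 * x * N)%N.
  have -> : (\sum_v f v ^ 2 = \sum_(w in X) \sum_(w' in X)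
      #|[set v | (dot v w == l) && (dot v w' == l)]|)%N.
    transitivity (\sum_v \sum_(w in X) \sum_(w' in X)
      ((dot v w == l) && (dot v w' == l)))%N.
      apply: eq_bigr => v _; rewrite -mulnn /f !card_filter big_distrl /=.
      apply: eq_bigr => w _; rewrite big_distrr /=; apply: eq_bigr => w' _.
      by rewrite mulnb.
    rewrite exchange_big /=; apply: eq_bigr => w _; rewrite exchange_big /=.
    by apply: eq_bigr => w' _; rewrite -sum1dep_card [RHS]big_mkcond; apply: eq_bigr.
  have -> : (x ^ 2 * N + M ^ 2 * x * N = \sum_(w in X) (x * N + M * (M * N)))%N.
    by rewrite sum_nat_const -/x; lia.
  rewrite big_distrr /=; apply: leq_sum => w wX; rewrite big_distrr /=.
  (* For fixed [w], at most [M] vectors are multiples of it and count at most [N / M] each; every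
     other one counts exactly [N / M ^ 2]. *)
  pose dep w' := [exists c, w' == c *: w].
  apply: leq_trans (@sum_split_leq _ X (fun w' => ~~ dep w') _ N (M * N)%N _ _) _.
  - move=> w' _; rewrite negb_exists => /forallP indep.
    by rewrite /N -(card_dot2 l (wn0 w wX) indep) mulnC.
  - move=> w' _; rewrite /N -(card_dot l (wn0 w wX)) -mulnn -mulnA leq_mul2l mulnC.
    rewrite leq_mul2r; apply/orP; right; apply/orP; right.
    by apply/subset_leq_card/subsetP=> v; rewrite !inE => /andP[].
  rewrite leq_add2l leq_mul2r; apply/orP; right.
  apply: leq_trans (card_multiples_leq w X); apply/subset_leq_card/subsetP=> w'.
  by rewrite !inE negbK.
(* This is [4 * (y - x) ^ 2 >= x ^ 2] for exceptional [v], expanded to avoid subtraction, with [y]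
   standing for [M * f v]. *)
have point v : (8 * x * (M * f v) + (v \in Ex) * x ^ 2 <= 4 * M ^ 2 * f v ^ 2 + 4 * x ^ 2)%N.
  rewrite inE -/(f v) -/x; set y := (M * f v)%N.
  have -> : (4 * M ^ 2 * f v ^ 2 = 4 * y ^ 2)%N by rewrite expnMn mulnA.
  rewrite -(mulnA 2 M) -/y -!mulnn; case: andP => [_|not_typ] /=.
    by have [+ _] := (nat_Cauchy x y); rewrite -!mulnn; lia.
  have : (2 * y < x)%N || (2 * x < y)%N.
    by apply/negPn/negP; rewrite negb_or -!leqNgt => /andP[? ?]; apply: not_typ.
  by case/orP=> lt_xy; [have -> : x = (2 * y + (x - 2 * y))%N by lia | have -> : y = (2 * x + (y - 2 * x))%N by lia]; nia.
have : (8 * x ^ 2 * N + #|Ex| * x ^ 2 <= 8 * x ^ 2 * N + 4 * M ^ 2 * x * N)%N.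
  have : (\sum_v (8 * x * (M * f v) + (v \in Ex) * x ^ 2) <=
          \sum_v (4 * M ^ 2 * f v ^ 2 + 4 * x ^ 2))%N by apply: leq_sum.
  rewrite [leqLHS]big_split [leqRHS]big_split /= sum_nat_const -!big_distrr -big_distrl /= sum1 -/N.
  have -> : (\sum_v (v \in Ex) = #|Ex|)%N.
    by rewrite -sum1_card [RHS]big_mkcond; apply: eq_bigr.
  rewrite -!mulnn in sum2 *; move: (\sum_v _)%N sum2 => S; clearbody x M N; move: #|Ex| => E; clear; lia.
rewrite leq_add2l => le_Ex.
have x_gt0 : (0 < x)%N by apply: leq_trans le_sX.
have le_Exx : (#|Ex| * x <= s ^ 2)%N.
  apply: leq_trans le_s; rewrite -(leq_pmul2r x_gt0); nia.
by rewrite -(leq_pmul2r s_gt0); nia.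
Qed.

End DotProduct.

(** * Ordering edges by label *)

Section ColorClass.
Variables (T : finType) (lam : T -> T -> nat).
Implicit Types (v w : T) (d e : {set T}).

(** The maximum runs over the two orderings of the endpoints; for symmetric [lam] it is their common
    label. *)
Definition edge_label e :=
  \max_(p : T * T | (p.1 != p.2) && (e == [set p.1; p.2])) lam p.1 p.2.

(** The label is the leading digit and the enumeration index breaks ties, which makes the order
    total and antisymmetric. *)
Definition edge_key e := edge_label e * #|{set T}| + enum_rank e.

Lemma edge_label2 v w : (forall v w, lam v w = lam w v) -> v != w ->
  edge_label [set v; w] = lam v w.
Proof.
move=> lamC v_w; apply/eqP; rewrite eqn_leq; apply/andP; split; last first.
  by apply: (leq_bigmax_cond (v, w)); rewrite v_w eqxx.
apply/bigmax_leqP=> -[v' w'] /= /andP[v_w' /eqP eq_e].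
have: v' \in [set v; w] by rewrite eq_e set21.
have: w' \in [set v; w] by rewrite eq_e set22.
rewrite !inE => /orP[]/eqP eq_w' /orP[]/eqP eq_v'; move: v_w';
  by rewrite eq_v' eq_w' ?eqxx // lamC.
Qed.

Lemma edge_key_inj : injective edge_key.
Proof.
move=> d e eq_key; apply: enum_rank_inj; apply: val_inj => /=.
have := congr1 (modn^~ #|{set T}|) eq_key.
by rewrite /edge_key !modnMDl !modn_small.
Qed.

Lemma edge_key_lt d e : edge_label d < edge_label e -> edge_key d < edge_key e.
Proof.
move=> lt_de; apply: leq_trans (leq_addr _ _).
apply: leq_trans (_ : (edge_label d).+1 * #|{set T}| <= _).
  by rewrite /edge_key mulSnr ltn_add2l ltn_ord.
by rewrite leq_mul2r lt_de orbT.
Qed.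

Variable P : pred {set T}.
Let class := [set e : {set T} | (#|e| == 2) && P e].
Let key_le : rel {set T} := fun d e => edge_key d <= edge_key e.

Let class_sub : {in class, forall e, e \subset [set: T]}.
Proof. by move=> e _; apply: subsetT. Qed.

Let class_card2 : {in class, forall e, #|e| = 2}.
Proof. by move=> e; rewrite inE => /andP[/eqP]. Qed.

Let key_le_anti : {in class &, antisymmetric key_le}.
Proof. by move=> d e _ _ /anti_leq; apply: edge_key_inj. Qed.

Let key_le_trans : {in class & &, transitive key_le}.
Proof. by move=> e d f _ _ _; apply: leq_trans. Qed.

Let key_le_total : {in class &, total key_le}.
Proof. by move=> d e _ _; apply: leq_total. Qed.

(** With [P := xpredT] this is the complete host; every other [P] gives a subgraph on the same
    vertices with the inherited order. *)
Definition color_class : eograph T :=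
  EOGraph class_sub class_card2 key_le_anti key_le_trans key_le_total.

End ColorClass.

(** * Patterns of edge ranks and the copies they force *)

Section Pattern.
Variables (U : finType) (H : eograph U).
Implicit Types (d e : {set U}).

Definition edge_rank e := #|[set d in edges H | edge_le H d e && (d != e)]|.

Lemma edge_rank_lt d e : d \in edges H -> e \in edges H -> d != e ->
  edge_le H d e -> edge_rank d < edge_rank e.
Proof.
move=> dH eH d_e le_de; apply: proper_card; apply/properP; split.
  apply/subsetP=> f; rewrite !inE => /and3P[fH le_fd f_d]; rewrite fH.
  rewrite (edge_le_trans dH fH eH le_fd le_de) /=.
  apply: contraNneq f_d => eq_fe; rewrite eq_fe in le_fd *.
  by rewrite (edge_le_anti eH dH) // le_fd.
by exists d; rewrite !inE ?dH ?le_de ?d_e // eqxx !andbF.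
Qed.

Lemma edge_rank_leq e : e \in edges H -> edge_rank e < #|vertices H| ^ 2.
Proof.
move=> eH; apply: (@leq_trans #|edges H|).
  apply: proper_card; apply/properP; split; last first.
    by exists e => //; rewrite inE eqxx !andbF.
  by apply/subsetP=> d; rewrite inE => /andP[].
apply: leq_trans (_ : #|[set [set p.1; p.2] | p in setX (vertices H) (vertices H)]| <= _).
  apply/subset_leq_card/subsetP=> d dH.
  have /eqP/cards2P[a [b [a_b eq_d]]] := edges_card2 dH.
  have /subsetP sd := edges_sub dH; rewrite eq_d.
  by apply/imsetP; exists (a, b); rewrite // inE !sd ?eq_d ?set21 ?set22.
by rewrite -mulnn -cardsX leq_imset_card.
Qed.

End Pattern.

(** The digit of an edge is its rank in [H], so labels that increase with the digits reproduce the
    order of [H]. *)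
Lemma pattern_exists (U : finType) (H : eograph U) (n d : nat) :
    0 < n -> #|vertices H| = n -> n ^ 2 <= d ->
  exists pat : nat -> nat -> nat, (forall i j, pat i j < d) /\
    forall (T : finType) (lam : T -> T -> nat) (P : pred {set T}) (v : nat -> T),
      (forall v w, lam v w = lam w v) ->
      (forall i j, i < j < n -> v i != v j /\ P [set v i; v j]) ->
      (forall i j i' j', i < j < n -> i' < j' < n -> pat i j < pat i' j' ->
         lam (v i) (v j) < lam (v i') (v j')) ->
    contains_copy (color_class lam P) H.
Proof.
move=> n_gt0 cardH le_d; have [x0 x0V] : exists x0, x0 \in vertices H.
  by apply/card_gt0P; rewrite cardH.
have d_gt0 : 0 < d by apply: leq_trans le_d; rewrite expn_gt0 n_gt0.
pose u i := nth x0 (enum (vertices H)) i.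
pose idx x := index x (enum (vertices H)).
have idxK x : x \in vertices H -> u (idx x) = x.
  by move=> xV; rewrite /u nth_index ?mem_enum.
have idx_lt x : x \in vertices H -> idx x < n.
  by move=> xV; rewrite -cardH cardE index_mem mem_enum.
(* Non-edges receive the arbitrary digit 0; their images are left out of the copy. *)
pose pat i j := if [set u i; u j] \in edges H then edge_rank H [set u i; u j] else 0.
exists pat; split=> [i j|T lam P v lamC vP v_mono].
  by rewrite /pat; case: ifP => // eH; apply: leq_trans le_d; rewrite -cardH edge_rank_leq.
pose g x := v (idx x).
have edge2 e : e \in edges H -> exists i j, [/\ i < j < n, e = [set u i; u j],
    g @: e = [set v i; v j] & pat i j = edge_rank H e].
  move=> eH; have /eqP/cards2P[a [b [a_b eq_e]]] := edges_card2 eH.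
  have /subsetP se := edges_sub eH.
  have [aV bV] : a \in vertices H /\ b \in vertices H.
    by rewrite !se // eq_e ?set21 ?set22.
  have [lt_ab|lt_ba|eq_ab] := ltngtP (idx a) (idx b).
  - exists (idx a), (idx b); rewrite lt_ab idx_lt // !idxK // -eq_e; split=> //.
      by rewrite eq_e imsetU1 imset_set1.
    by rewrite /pat !idxK // -eq_e eH.
  - exists (idx b), (idx a); rewrite lt_ba idx_lt // !idxK // setUC -eq_e; split=> //.
      by rewrite eq_e imsetU1 imset_set1 setUC.
    by rewrite /pat !idxK // setUC -eq_e eH.
  by case/eqP: a_b; rewrite -(idxK a aV) -(idxK b bV) eq_ab.
have g_inj : {in vertices H &, injective g}.
  move=> a b aV bV; rewrite /g => eq_v.
  have [lt_ab|lt_ba|eq_ab] := ltngtP (idx a) (idx b); last by rewrite -(idxK a aV) eq_ab idxK.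
    have [] := vP (idx a) (idx b); first by rewrite lt_ab idx_lt.
    by rewrite eq_v eqxx.
  have [] := vP (idx b) (idx a); first by rewrite lt_ba idx_lt.
  by rewrite eq_v eqxx.
(* [equivalent] asks for a map from the copy to [H], hence the inverse of [g], with default [x0] off
   its image. *)
pose f t := if [pick x in vertices H | g x == t] is Some x then x else x0.
have gK x : x \in vertices H -> f (g x) = x.
  rewrite /f => xV; case: pickP => [y /andP[yV /eqP/g_inj]|/(_ x)]; first exact.
  by rewrite xV eqxx.
have gKs (e : {set U}) : e \subset vertices H -> f @: (g @: e) = e.
  move=> /subsetP sV; rewrite -imset_comp -[RHS]imset_id; apply: eq_in_imset => x xe.
  by rewrite /= gK ?sV.
have label_g e : e \in edges H -> forall i j, i < j < n -> g @: e = [set v i; v j] ->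
    edge_label lam (g @: e) = lam (v i) (v j).
  by move=> _ i j lt_ij ->; have [v_ij _] := vP i j lt_ij; rewrite edge_label2.
have key_lt a b : a \in edges H -> b \in edges H -> a != b -> edge_le H a b ->
    edge_key lam (g @: a) < edge_key lam (g @: b).
  move=> aH bH a_b le_ab; apply: edge_key_lt.
  have [i [j [lt_ij _ ga pa]]] := edge2 a aH; have [i' [j' [lt_ij' _ gb pb]]] := edge2 b bH.
  rewrite (label_g a aH i j) // (label_g b bH i' j') //.
  by apply: v_mono => //; rewrite pa pb edge_rank_lt.
have key_le a b : a \in edges H -> b \in edges H ->
    (edge_key lam (g @: a) <= edge_key lam (g @: b)) = edge_le H a b.
  move=> aH bH; have [->|a_b] := eqVneq a b.
    by rewrite leqnn; have := edge_le_total bH bH; rewrite orbb.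
  have /orP[le_ab|le_ba] := edge_le_total aH bH.
    by rewrite le_ab ltnW // key_lt.
  rewrite leqNgt key_lt // 1?eq_sym //; apply/esym/negP => le_ab.
  by case/eqP: a_b; apply: (edge_le_anti aH bH); rewrite le_ab.
have g_edge e : e \in edges H -> (#|g @: e| == 2) && P (g @: e).
  move=> eH; have [i [j [lt_ij _ -> _]]] := edge2 e eH; have [v_ij ->] := vP i j lt_ij.
  by rewrite cards2 v_ij.
pose E := [set g @: (e : {set U}) | e in edges H].
have sub : {in E, forall e : {set T}, e \subset g @: vertices H}.
  by move=> _ /imsetP[e eH ->]; apply/imsetS/edges_sub.
have card2 : {in E, forall e : {set T}, #|e| = 2}.
  by move=> _ /imsetP[e /g_edge/andP[/eqP ? _] ->].
pose le : rel {set T} := fun d e => edge_key lam d <= edge_key lam e.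
have anti : {in E &, antisymmetric le}.
  by move=> ? ? _ _ /anti_leq; apply: edge_key_inj.
have trans : {in E & &, transitive le} by move=> ? ? ? _ _ _; apply: leq_trans.
have tot : {in E &, total le} by move=> ? ? _ _; apply: leq_total.
exists (EOGraph sub card2 anti trans tot).
  split=> //=.
  by apply/subsetP=> _ /imsetP[e /g_edge ? ->]; rewrite inE.
exists f; split=> /=.
- by move=> _ _ /imsetP[x xV ->] /imsetP[y yV ->]; rewrite !gK // => ->.
- exact: gKs.
- move=> _ _ /imsetP[x xV ->] /imsetP[y yV ->]; rewrite !gK //.
  have -> : [set g x; g y] = g @: [set x; y] by rewrite imsetU1 imset_set1.
  apply/imsetP/idP => [[e eH eq_e] | xyH]; last by exists [set x; y].
  have sxy : [set x; y] \subset vertices H.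
    by apply/subsetP=> z; rewrite !inE => /orP[]/eqP->.
  by rewrite -(gKs _ sxy) eq_e (gKs _ (edges_sub eH)).
- move=> _ _ /imsetP[a aH ->] /imsetP[b bH ->].
  by rewrite (gKs _ (edges_sub aH)) (gKs _ (edges_sub bH)); apply: key_le.
Qed.

(** * Choice of the parameters *)

Lemma edg_neq_leq (T : finType) (R : rel T) (A B : {set T}) :
  edg (fun v w => (v == w) || R v w) A B <= #|A| + edg R A B.
Proof.
rewrite -sum1_card /edg -big_split /=; apply: leq_sum => v _.
apply: leq_trans (_ : #|[set v] :|: [set w in B | R v w]| <= _).
  by apply/subset_leq_card/subsetP=> w; rewrite !inE => /andP[->]; rewrite eq_sym.
by apply: leq_trans (leq_card_setU _ _) _; rewrite cards1.
Qed.

(** The colours are [0, ..., q]: those below [q] are made sparse by [sparse_sets], then pattern [q]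
    is embedded while avoiding them. The exponent of [M] counts the digits of the tree and one for
    this last pattern. *)
Lemma some_pattern (T : finType) (lam col : T -> T -> nat) (host : {set T})
    (n D d q s G : nat) (pat : nat -> nat -> nat -> nat) :
    0 < n -> n <= 2 ^ D -> 1 < d -> 0 < s -> (forall k i j, pat k i j < d) ->
    (forall v w, lam v w = lam w v) -> (forall v w, col v w <= q) ->
    let M := d ^ (num_digits n q).+1 in
    let K := (1024 * n ^ 2) ^ n * M in
    typical_labelling lam host M s -> 2 * K <= 2 ^ G ->
    2 ^ loss_exp n D q G * ((4 * M) ^ n * (s * M ^ 2 * K)) <= #|host| ->
  ~ (forall k, k <= q -> pattern_free lam col n d pat k).
Proof.
move=> n_gt0 le_n d_gt1 s_gt0 lt_pat lamC le_col M K typ le_K le_host free.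
have d_gt0 : 0 < d by apply: ltnW.
have M_gt0 : 0 < M by rewrite expn_gt0 d_gt0.
have K_gt0 : 0 < K by rewrite muln_gt0 expn_gt0 !(muln_gt0, n_gt0, M_gt0).
have sMK_gt0 : 0 < s * M ^ 2 * K by rewrite !(muln_gt0, s_gt0, M_gt0, K_gt0).
have t_gt0 : 0 < (4 * M) ^ n * (s * M ^ 2 * K).
  by rewrite muln_gt0 expn_gt0 sMK_gt0 muln_gt0 M_gt0.
have free_lt k : k < q -> pattern_free lam col n d pat k by move=> /ltnW/free.
(* All labels below [M] form block 0 of the top scale; starting from [j = 1] leaves the last digit
   free. *)
have [Xs [c [size_Xs all_Xs c_0 sparse]]] :=
  sparse_sets n_gt0 le_n lt_pat free_lt 1 0 t_gt0 le_host.
have c_lt i j : c * d + pat q i j < M.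
  have lt_c : c < d ^ num_digits n q.
    by rewrite ltnNge -divn_gt0 ?c_0 // expn_gt0 d_gt0.
  rewrite /M expnSr; apply: (@leq_trans (c * d + d)); first by rewrite ltn_add2l.
  by rewrite addnC -mulSn leq_mul2r lt_c orbT.
have [x0 _] : exists x0, x0 \in host.
  by apply/card_gt0P/(leq_trans _ le_host); rewrite muln_gt0 expn_gt0 t_gt0.
have inX i : i < n -> nth set0 Xs i \subset host /\
    (4 * M) ^ n * (s * M ^ 2 * K) <= #|nth set0 Xs i|.
  by move=> lt_i; apply/andP; apply: (allP all_Xs); rewrite mem_nth ?size_Xs.
(* The sets may overlap, so equality is added to the forbidden relation to force distinct vertices;
   [edg_neq_leq] bounds its cost. *)
pose R v w := (v == w) || low_color lam col q (d ^ 1) c v w.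
have [|v [_ v_lab]] := typical_embedding M_gt0 lamC typ x0 s_gt0 n_gt0 (leqnn n)
  (leqnn M) (leqnn (s * M ^ 2 * K)) inX (L := fun i j => c * d + pat q i j) (R := R) (fun i j _ => c_lt i j).
  move=> i j /andP[lt_ij lt_j]; rewrite -/K.
  have lt_i := ltn_trans lt_ij lt_j.
  have := sparse => /(pairwiseP set0)/(_ i j); rewrite !inE size_Xs.
  move=> /(_ lt_i lt_j lt_ij) le_ij.
  have [_ le_Xj] := inX j lt_j.
  have le_2K : 2 * K <= #|nth set0 Xs j|.
    apply: leq_trans le_Xj; apply: (@leq_trans (s * M ^ 2 * K)); last first.
      by rewrite leq_pmull // expn_gt0 muln_gt0 M_gt0.
    rewrite leq_mul2r; apply/orP; right; apply: (@leq_trans (M ^ 2)).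
      apply: (@leq_trans M); last by rewrite -mulnn leq_pmull.
      by rewrite -[2]/(2 ^ 1) /M; apply: leq_trans (leq_pexp2l d_gt0 (ltn0Sn _)); rewrite expn1.
    by rewrite leq_pmull.
  have := edg_neq_leq (low_color lam col q (d ^ 1) c) (nth set0 Xs i) (nth set0 Xs j).
  rewrite -/R; move: le_ij le_2K le_K.
  set e := edg _ _ _; set e' := edg _ _ _; set x := #|_|; set y := #|_|.
  move=> le_ij le_2K le_K le_e.
  have : e * (2 * K) <= x * y by apply: leq_trans le_ij; rewrite leq_mul2l le_K orbT.
  have : x * (2 * K) <= x * y by rewrite leq_mul2l le_2K orbT.
  by nia.
apply: (free q (leqnn q) 1 c v) => i j lt_ij.
have [lam_ij] := v_lab i j lt_ij.
rewrite /R /low_color /pattern_edge divn1 lam_ij eqxx andbT negb_or => /andP[v_ij].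
rewrite v_ij /= expn1 divnMDl // divn_small // addn0 eqxx andbT -leqNgt => ge_q.
by rewrite eqn_leq le_col ge_q.
Qed.

Lemma num_digits_leq n k : 0 < n -> (num_digits n k).+1 <= n ^ k.
Proof.
move=> n_gt0; elim: k => //= k IHk.
by rewrite expnS; apply: leq_trans (_ : n * (num_digits n k).+1 <= _); [nia | rewrite leq_mul2l IHk orbT].
Qed.

(** The second summand on the left strengthens the induction: a recursion step multiplies
    [3 + D + G] by at most [3 * n], and the slack pays for the additive cost [1 + rho]. *)
Lemma loss_exp_leq n D k G : 1 < n -> 0 < D -> 2 * D <= G ->
  2 * loss_exp n D k.+1 G + n * (3 + D + G) * D ^ k.+1 <=
    4 * (3 * n) ^ k * (n * (3 + D + G) * D ^ k.+1).
Proof.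
move=> n_gt1 D_gt0; elim: k G => [|k IHk] G le_G; set E := 3 + D + G.
  by rewrite /= -/E muln1 expn1 addn0; rewrite /E; clear E; nia.
rewrite [loss_exp _ _ _ _]/= -/E -[D * _]/(D * (1 + (D + n * E) + loss_exp n D k.+1 (E + 2 * (D + n * E)))).
have le_E : 3 * D + 3 <= E by rewrite /E; lia.
set G' := E + 2 * (D + n * E); have := IHk G' _; rewrite -/G'.
have -> : 2 * D <= G' by rewrite /G'; lia.
move/(_ isT); set E' := 3 + D + G'; have le_E' : E' <= 3 * n * E by rewrite /E' /G'; nia.
set l := loss_exp _ _ _ _; rewrite [D ^ k.+2]expnS [(3 * n) ^ k.+1]expnS.
have : 0 < D ^ k.+1 by rewrite expn_gt0 D_gt0.
have : 0 < (3 * n) ^ k by rewrite expn_gt0; case: (n) n_gt1.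
move: (D ^ k.+1) ((3 * n) ^ k) => P Q Q_gt0 P_gt0 le_l.
have le_l' : 2 * l + n * (3 * n * E) * P <= 4 * Q * (n * (3 * n * E) * P).
  have : n * E' * P <= n * (3 * n * E) * P by rewrite leq_mul2r leq_mul2l le_E' !orbT.
  by move: le_l; set x := n * E' * P; set y := n * _ * P; nia.
have le1 : 2 * (1 + (D + n * E)) <= 3 * (n * E * P).
  have : n * E <= n * E * P by rewrite leq_pmulr.
  by nia.
set z := n * E * P in le1.
have eq1 : n * (3 * n * E) * P = 3 * n * z by rewrite /z; lia.
rewrite eq1 in le_l'.
have -> : n * E * (D * P) = D * z by rewrite /z; lia.
have : 2 * (1 + (D + n * E) + l) + z <= 4 * (3 * n * Q) * z.
  have : 4 * z <= 3 * n * z by nia.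
  have -> : 4 * (3 * n * Q) * z = 4 * Q * (3 * n * z) by lia.
  by lia.
move=> /(leq_mul (leqnn D)); set w := 1 + _ + _; lia.
Qed.

(** Here [k.+2] is the number of colours. Every term is compared with [Y] or with [u], the quantity
    in the final bound. *)
Lemma exponent_leq n D k m G : 1 < n -> 0 < D ->
    m = 2 * D * (num_digits n k.+1).+1 -> G = (10 + 2 * D) * n + m + 1 ->
  8 * m + 2 * (loss_exp n D k.+1 G + n * (2 + m) + G + 1) <=
  8 * 4 ^ k.+2 * (n ^ (2 * k.+2 - 2) * D ^ k.+2).
Proof.
move=> n_gt1 D_gt0 eq_m eq_G; have n_gt0 := ltnW n_gt1.
pose Y := n ^ k.+1 * D.
have le_m : m <= 2 * Y.
  by rewrite eq_m /Y -mulnA leq_mul // mulnC leq_mul // num_digits_leq.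
have le_nDY : n * D <= Y by rewrite leq_mul2r -{1}[n]expn1 leq_pexp2l // orbT.
have le_D : 2 * D <= n * D by rewrite leq_mul2r n_gt1 orbT.
have le_n : n <= n * D by rewrite leq_pmulr.
have le_E : 3 + D + G <= 17 * Y.
  by rewrite eq_G mulnDl -(mulnA 2) (mulnC D); clearbody Y; lia.
have le_G : 2 * D <= G by rewrite eq_G mulnDl -(mulnA 2) (mulnC D); lia.
have le_loss := loss_exp_leq k n_gt1 D_gt0 le_G.
set l := loss_exp _ _ _ _ in le_loss *; set E := 3 + D + G in le_E le_loss.
pose u := n ^ (2 * k.+2 - 2) * D ^ k.+2.
have eq_u : u = n ^ k * n * D ^ k.+1 * Y.
  have -> : u = n ^ (k.+1 + k.+1) * D ^ k.+2.
    by rewrite /u; congr (_ ^ _ * _); lia.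
  by rewrite /Y expnD [D ^ k.+2]expnSr (expnSr n k); ring.
have le_l : 2 * l <= 68 * 3 ^ k * u.
  apply: leq_trans (leq_trans (leq_addr _ _) le_loss) _.
  rewrite eq_u expnMn.
  have -> : 4 * (3 ^ k * n ^ k) * (n * E * D ^ k.+1) =
    4 * 3 ^ k * (n ^ k * n * D ^ k.+1) * E by ring.
  have -> : 68 * 3 ^ k * (n ^ k * n * D ^ k.+1 * Y) =
    4 * 3 ^ k * (n ^ k * n * D ^ k.+1) * (17 * Y) by ring.
  by rewrite leq_mul2l le_E orbT.
have le_nY : n * Y <= u.
  rewrite eq_u leq_mul2r; apply/orP; right; rewrite -[leqLHS]mul1n -[leqLHS]muln1.
  by rewrite !leq_mul // expn_gt0 ?n_gt0 ?D_gt0.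
have le_nn : 4 <= n * n by apply: (@leq_mul 2 2).
have le_4n : 4 * n <= 2 * u by clearbody Y u; nia.
rewrite -/u; clear le_loss eq_u.
(* 68 is [4 * 17] from the loss, 60 covers the remaining terms; at [k = 0] both sides are 128. *)
have le_pow : 68 * 3 ^ k + 60 <= 8 * 4 ^ k.+2.
  have le34 : 3 ^ k <= 4 ^ k by case: (k) => // k'; rewrite leq_exp2r.
  have : 0 < 4 ^ k by rewrite expn_gt0.
  by rewrite !expnS; move: (3 ^ k) (4 ^ k) le34 => x y; lia.
have : (68 * 3 ^ k + 60) * u <= 8 * 4 ^ k.+2 * u by rewrite leq_mul2r le_pow orbT.
have : n * m <= 2 * u.
  by apply: leq_trans (_ : n * (2 * Y) <= _); [rewrite leq_mul2l le_m orbT | lia].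
have : 2 * Y <= u by clearbody Y u; nia.
have : G <= 17 * Y by apply: leq_trans le_E; rewrite leq_addl.
move: le_l; rewrite [(68 * 3 ^ k + 60) * u]mulnDl mulnDr.
move: (68 * 3 ^ k * u) (8 * 4 ^ k.+2 * u) (n * m) => x y z.
clearbody Y u l; nia.
Qed.

(** * Comparison with the real-valued vertex bound *)

Section Bound.
Local Open Scope ring_scope.

(** [2 ^ D <= n ^ 2] gives [D / 2 <= log2 n], and replacing the logarithm by [D / 2] turns
    [8 ^ (q + 1)] into [8 * 4 ^ q]. *)
Lemma num_vertices_geq (R : realType) (n D q e : nat) : (0 < n)%N -> (2 ^ D <= n ^ 2)%N ->
  (e <= 8 * 4 ^ q * (n ^ (2 * q - 2) * D ^ q))%N -> (2 ^ e <= num_vertices R n q)%N.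
Proof.
move=> n_gt0 le_D le_e.
have ln2_gt0 : 0 < ln (2 : R) by rewrite ln_gt0 // ltr1n.
have le_log : D%:R / 2 <= log2 n%:R :> R.
  rewrite /log2 ler_pdivlMr // mulrAC ler_pdivrMr //.
  have : ln ((2 : R) ^+ D) <= ln (n%:R ^+ 2).
    by rewrite ler_ln ?posrE ?exprn_gt0 ?ltr0n // -!natrX ler_nat.
  by rewrite !lnXn ?ltr0n // -[ln 2 *+ D]mulr_natl -[ln n%:R *+ 2]mulr_natr.
rewrite /num_vertices /vertex_bound truncn_ge_nat ?powR_ge0 //.
rewrite natrX -(@powR_mulrn R 2 e) ?ler0n //; apply: ler_powR; first by rewrite ler1n.
apply: le_trans (_ : (8 * 4 ^ q * (n ^ (2 * q - 2) * D ^ q))%N%:R <= _).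
  by rewrite ler_nat.
have -> : (8 * 4 ^ q * (n ^ (2 * q - 2) * D ^ q))%N%:R =
    8 ^+ q.+1 * n%:R ^+ (2 * q - 2) * (D%:R / 2) ^+ q :> R.
  rewrite !natrM !natrX exprMn exprVn exprS (_ : 8 ^+ q = 4 ^+ q * 2 ^+ q).
    by field; rewrite ?expf_neq0 ?pnatr_eq0.
  by rewrite -exprMn; congr (_ ^+ q); rewrite -natrM.
rewrite ler_wpM2l ?mulr_ge0 ?exprn_ge0 ?ler0n //.
have D2_ge0 : 0 <= D%:R / 2 :> R by rewrite divr_ge0 ?ler0n.
by apply: lerXn2r; rewrite // nnegrE // (le_trans D2_ge0 le_log).
Qed.

End Bound.

(** * The padded dot-product host *)

Section DotLabel.
Variables (F : finFieldType) (h r : nat).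
Local Notation T := ('rV[F]_h + 'I_r)%type.

(* The summand 'I_r only pads the vertex set; its labels are irrelevant. *)
Definition dot_label (x y : T) : nat :=
  if x is inl v then if y is inl w then enum_rank (dot v w) else 0 else 0.

Definition dot_host : {set T} := inl @: [set~ (0 : 'rV[F]_h)%R].

Lemma dot_labelC x y : dot_label x y = dot_label y x.
Proof. by case: x y => [v|?] [w|?] //=; rewrite dotC. Qed.

Lemma card_dot_host : #|dot_host| = (#|F| ^ h).-1.
Proof.
rewrite card_imset; last exact: inl_inj.
by rewrite cardsC1 card_mx mul1n.
Qed.

Lemma dot_label_typical s : 0 < s -> 4 * #|F| ^ 2 * #|F| ^ h <= s ^ 2 ->
  typical_labelling dot_label dot_host #|F| s.
Proof.
move=> s_gt0 le_s l X lt_l sX le_sX.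
pose l0 := enum_val (Ordinal lt_l).
pose X0 := [set w | inl w \in X].
have eqX : X = inl @: X0.
  apply/setP=> x; apply/idP/imsetP => [xX | [w + ->]]; last by rewrite inE.
  by have /imsetP[w _ eq_x] := subsetP sX x xX; exists w; rewrite // inE -eq_x.
have cardX : #|X| = #|X0| by rewrite eqX card_imset //; exact: inl_inj.
have degX v : deg (label_rel dot_label l) (inl v) X = #|[set w in X0 | dot v w == l0]|.
  rewrite -(card_imset [set w in X0 | dot v w == l0] (@inl_inj _ 'I_r)).
  apply: eq_card => x; rewrite inE; apply/andP/imsetP.
    case=> + lab_x; rewrite eqX => /imsetP[w w0 eq_x]; exists w => //.
    rewrite inE w0; move: lab_x; rewrite eq_x /label_rel /= => /eqP lab_w.
    by rewrite -(enum_rankK (dot v w)) /l0; apply/eqP; congr enum_val; apply: val_inj.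
  case=> w; rewrite inE => /andP[w0 /eqP dot_w] ->; split.
    by rewrite eqX; apply/imsetP; exists w.
  by rewrite /label_rel /= dot_w enum_valK.
have X0_neq0 : X0 \subset [set~ 0%R].
  apply/subsetP=> w; rewrite inE => /(subsetP sX)/imsetP[w' w'_neq0 [->]].
  by [].
rewrite cardX in le_sX.
have le_s' : 4 * #|F| ^ 2 * #|{: 'rV[F]_h}| <= s ^ 2 by rewrite card_mx mul1n.
apply: leq_trans (dot_typical l0 X0_neq0 le_sX s_gt0 le_s').
rewrite -[leqRHS](card_imset _ (@inl_inj _ 'I_r)).
apply/subset_leq_card/subsetP=> x; rewrite inE => /andP[/imsetP[v _ ->]].
by rewrite /typical degX cardX => not_typ; apply/imsetP; exists v; rewrite ?inE.
Qed.

End DotLabel.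

Theorem theorem3 (R : realType) (n q : nat) (n_gt0 : 0 < n) (q_ge2 : 2 <= q) :
  exists (T : finType) (G : eograph T),
    #|vertices G| = num_vertices R n q /\
    forall c : {set T} -> 'I_q,
      exists S : eograph T,
        [/\ subgraph S G,
            monochromatic c S &
            forall (U : finType) (H : eograph U),
              #|vertices H| = n -> contains_copy S H].
Proof.
have sub_class (T : finType) (lam : T -> T -> nat) P :
    subgraph (color_class lam P) (color_class lam xpredT).
  by split=> //=; apply/subsetP=> e; rewrite !inE => /andP[->].
have [n_gt1|] := ltnP 1 n; last first.
  (* For [n = 1] a single vertex is a copy of every [H]; the construction below needs [D > 0]. *)
  move=> n_le1; have n1 : n = 1 by apply/eqP; rewrite eqn_leq n_le1.
  have N_gt0 : 0 < num_vertices R n q by apply: (@num_vertices_geq R n 0 q 0); rewrite // n1.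
  exists 'I_(num_vertices R n q), (color_class (fun _ _ => 0) xpredT).
  rewrite cardsT card_ord; split=> // c.
  exists (color_class (fun _ _ => 0) xpred0); split=> //.
    exists (Ordinal (ltnW q_ge2)) => e; by rewrite inE andbF.
  move=> U H cardH; have [pat [_ copy]] := pattern_exists n_gt0 cardH (leqnn _).
  by apply: (copy _ _ _ (fun=> Ordinal N_gt0)) => // i j; move: n_le1; clear; lia.
case: q q_ge2 => [|[|k]] // _.
pose D := up_log 2 n.
(* [D] is the rounded-up binary logarithm of [n]. Below, [m] is chosen so that a field of order
   [2 ^ m] has exactly [d ^ a] labels for [d = 2 ^ (2 * D)], and [b] so that [z + 3 * m <= m * b];
   the vectors have length [2 * b]. *)
have /andP[lt_D le_D] := up_log_bounds (isT : 1 < 2) n_gt1.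
have D_gt0 : 0 < D by rewrite lt0n; apply/eqP => D0; rewrite -/D D0 in le_D; lia.
pose a := (num_digits n k.+1).+1; pose m := 2 * D * a.
pose G := (10 + 2 * D) * n + m + 1.
pose z := loss_exp n D k.+1 G + n * (2 + m) + G + 1.
pose b := (z %/ m).+4.
have m_gt0 : 0 < m by rewrite !muln_gt0 D_gt0.
have le_z : z + 3 * m <= m * b.
  have : z <= m * (z %/ m).+1 by rewrite mulnC ltnW // ltn_ceil.
  have -> : b = (z %/ m).+1 + 3 by rewrite addn3.
  by rewrite mulnDr (mulnC m 3) leq_add2r.
have [F _ cardF] := PrimePowerField (isT : prime 2) m_gt0.
pose M := 2 ^ m.
set N := num_vertices R n k.+2.
have le_N : #|F| ^ (2 * b) <= N.
  rewrite cardF -expnM; apply: (@num_vertices_geq R n D) => //.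
    move: lt_D; rewrite -/D -[in 2 ^ D](prednK D_gt0) expnS -mulnn.
    by move: (2 ^ D.-1) n_gt1 => P; clear; nia.
  apply: leq_trans (exponent_leq n_gt1 D_gt0 (erefl m) (erefl G)).
  have -> : m * (2 * b) = 8 * m + 2 * (z %/ m * m) by rewrite /b; move: (z %/ m) => x; lia.
  by rewrite leq_add2l leq_mul2l leq_divM.
(* Padding brings the number of vertices to exactly [N]. *)
pose r := N - #|F| ^ (2 * b).
pose T : finType := ('rV[F]_(2 * b) + 'I_r)%type.
pose lam : T -> T -> nat := @dot_label F (2 * b) r.
exists T, (color_class lam xpredT); split.
  by rewrite cardsT card_sum card_ord card_mx mul1n subnKC.
move=> c; apply: contrapT => no_S.
pose S (i : 'I_k.+2) := color_class lam (fun e => c e == i).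
have missing i : exists U (H : eograph U), #|vertices H| = n /\ ~ contains_copy (S i) H.
  apply: contrapT => no_H; apply: no_S; exists (S i); split; first exact: sub_class.
    by exists i => e; rewrite inE => /andP[_ /eqP].
  by move=> U H cardH; apply: contrapT => no_copy; apply: no_H; exists U, H.
pose d := 2 ^ (2 * D).
have le_d : n ^ 2 <= d by rewrite /d mulnC expnM leq_exp2r.
have pattern i : exists p : nat -> nat -> nat, (forall x y, p x y < d) /\
    forall v : nat -> T, (forall x y, x < y < n -> v x != v y /\ c [set v x; v y] == i) ->
      ~ (forall x y x' y', x < y < n -> x' < y' < n -> p x y < p x' y' ->
         lam (v x) (v y) < lam (v x') (v y')).
  have [U [H [cardH no_copy]]] := missing i.
  have [p [lt_p copy]] := pattern_exists n_gt0 cardH le_d.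
  by exists p; split=> // v v_col v_mono; apply/no_copy/(copy _ _ _ v) => //; apply: dot_labelC.
have [p pP] := fin_all_exists pattern.
pose pat x := oapp p (fun _ _ => 0) (insub x).
pose col (v w : T) : nat := c [set v; w].
have d_gt1 : 1 < d.
  by apply: leq_trans le_d; apply: leq_trans n_gt1 _; rewrite -mulnn leq_pmulr.
have eq_M : d ^ a = M by rewrite /d -expnM.
have le_K : 2 * ((1024 * n ^ 2) ^ n * M) <= 2 ^ G.
  rewrite /G addn1 [2 ^ _.+1]expnS leq_mul2l; apply/orP; right.
  rewrite expnD leq_mul2r expnM leq_exp2r //; apply/orP; right.
  by rewrite expnD; apply: leq_mul; last exact: le_d.
(* [s = 2 * M ^ b.+1] is the square root of [4 * M ^ 2 * M ^ (2 * b)], as Chebyshev's inequality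
   requires. *)
apply: (@some_pattern T lam col (@dot_host F (2 * b) r) n D d k.+1 (2 * M ^ b.+1) G pat) => //.
- by rewrite muln_gt0 expn_gt0 expn_gt0.
- move=> x y w; rewrite /pat; case: insubP => [i _ _|_] /=; last by apply: ltnW.
  by have [] := pP i.
- exact: dot_labelC.
- by move=> v w; rewrite -ltnS ltn_ord.
- rewrite -/a eq_M -[M]cardF; apply: dot_label_typical.
    by rewrite muln_gt0 expn_gt0 cardF expn_gt0.
  by rewrite expnMn -mulnA leq_mul2l -expnM -expnD cardF -!expnM leq_exp2l //=; lia.
- by rewrite -/a eq_M.
- rewrite -/a eq_M card_dot_host cardF -/M.
  set lhs := 2 ^ _ * _; suff: 2 * lhs <= M ^ (2 * b).
    have : 0 < M ^ (2 * b) by rewrite !expn_gt0.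
    by move: (M ^ (2 * b)) => x; clear; lia.
  have -> : 2 * lhs = 2 ^ loss_exp n D k.+1 G * (4 * M) ^ n * (2 * M ^ b.+1 * M ^ 2) *
      (2 * ((1024 * n ^ 2) ^ n * M)) by rewrite /lhs; ring.
  apply: leq_trans (leq_mul (leqnn _) le_K) _.
  have -> : 4 * M = 2 ^ (2 + m) by rewrite expnD.
  rewrite -[2 * M ^ b.+1]/(2 ^ 1 * M ^ b.+1) /M -!expnM -!expnD leq_exp2l //.
  by move: le_z; rewrite /z; clear; nia.
move=> x lt_x L c' v edges.
have [_ no_copy] := pP (Ordinal (lt_x : x < k.+2)).
have pat_x : pat x = p (Ordinal (lt_x : x < k.+2)) by rewrite /pat insubT.
apply: (no_copy v) => [i j lt_ij | i j i' j' lt_ij lt_ij' lt_p].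
  by have /and3P[v_ij col_ij _] := edges i j lt_ij.
have /and3P[_ _ /eqP lab_ij] := edges i j lt_ij.
have /and3P[_ _ /eqP lab_ij'] := edges i' j' lt_ij'.
(* Both labels lie in one block, so division by [L] reduces their comparison to that of the
   digits. *)
rewrite ltnNge; apply/negP => /(leq_div2r L).
by rewrite lab_ij lab_ij' leq_add2l leqNgt pat_x lt_p.
Qed.
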